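(* Let $p,q\ge1$ be integers with $\gcd(p,q)=1$, $n=p+q$, let $\ell\in\{0,1\}$ and $a,c\in\mathbb{C}$. Write $\varepsilon_r=\exp(2\pi i/r)$; a hat over a parameter means it is omitted. Let $$G_0(A,B,C;y)={}_2F_1\left(\begin{array}{c}C,\,1\\ \frac{A+C}B+1\end{array}\mid\frac{y-1}y\right),$$ $$G_1(A,B,C;y)=\left[\frac{y}{(1-B)y+B}\right]{}_3F_2\left(\begin{array}{c}C,\,\frac{A+1}{B-1}+1,\,1\\ \frac{A+C+1}{B}+1,\,\frac{A+1}{B-1}\end{array}\mid\frac{y-1}y\right).$$ (i) Near $\zeta=0$, for arbitrary fixed $g>0$ and for $\kappa=0,\dots,q-1$, $$\zeta^{\kappa/q}\,{}_{n+1}F_{n}\left(\begin{array}{l}\frac{a}n+\frac{\kappa}q,\dots,\frac{a+(n-1)}n+\frac{\kappa}q;\ \frac{a+c-\ell}p+\frac\kappa{q}\\ \frac{a-\ell}p+\frac{\kappa}q,\dots,\frac{a-\ell+(p-1)}p+\frac{\kappa}q;\ \frac1q+\frac{\kappa}q,\dots,\widehat{\frac{q-\kappa}{q}+\frac{\kappa}q},\dots,\frac{q}q+\frac{\kappa}q;\ \frac{a+c-\ell+p}{p}+\frac\kappa{q}\end{array}\mid\zeta\right)$$ $$=\frac{(-1)^\kappa(1)_\kappa(a+n\kappa/q)_{-\ell-\kappa}(a+c-\ell+p\kappa/q)}{(a)_{-\ell}(a+c-\ell)}\left[\frac{(-1)^qn^n}{p^pq^q}\right]^{\kappa/q}\cdot\frac1q\sum_{j=1}^q(\varepsilon_q^{-n})^{(j-1)\kappa}[\varepsilon_q^{j-1}g^{-1/q}x_j]^{-qa}\,G_\ell(-a,-p/q,-c;\,g^{-1}x_j^q),$$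 where $x_j$ ($j=1,\dots,q$) is the root of $x^n-g\,x^p-\beta=0$ near $\varepsilon_q^{-(j-1)}g^{1/q}$ (for $\beta$ near $0$), with $\beta$ determined by $\zeta=(-1)^q\frac{n^n}{p^pq^q}\frac{\beta^q}{g^n}$. (ii) Near $\zeta=\infty$, for arbitrary fixed $\beta>0$ and for $\kappa=0,\dots,n-1$, $$\zeta^{-\kappa/n}\,{}_{n+1}F_{n}\left(\begin{array}{l}\frac{-a+\ell+1}p+\frac{\kappa}n,\dots,\frac{-a+\ell+p}p+\frac{\kappa}n;\ \frac{a}q+\frac{\kappa}n,\dots,\frac{a+(q-1)}q+\frac{\kappa}n;\ \frac{-a-c+\ell}p+\frac\kappa{n}\\ \frac1n+\frac{\kappa}n,\dots,\widehat{\frac{n-\kappa}n+\frac\kappa{n}},\dots,\frac{n}n+\frac{\kappa}n;\ \frac{-a-c+\ell+p}p+\frac{\kappa}n\end{array}\mid\zeta^{-1}\right)$$ $$=\frac{(-1)^\kappa(1)_\kappa(a+q\kappa/n)_{-\ell-\kappa}(a+c-\ell-p\kappa/n)}{(a)_{-\ell}(a+c-\ell)}\left[\frac{(-1)^qn^n}{p^pq^q}\right]^{-\kappa/n}\cdot\frac1n\sum_{j=1}^n(\varepsilon_n^{-q})^{(j-1)\kappa}[\varepsilon_n^{j-1}\beta^{-1/n}x_j]^{-na}\,G_\ell(-a,p/n,-c;\,\beta^{-1}x_j^n),$$ where $x_j$ ($j=1,\dots,n$) is the root of $x^n-g\,x^p-\beta=0$ near $\varepsilon_n^{-(j-1)}\beta^{1/n}$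 (for $g$ near $0$), with $g$ determined by $\zeta=(-1)^q\frac{n^n}{p^pq^q}\frac{\beta^q}{g^n}$. In (i) and (ii), $a,c$ are constrained so that no division by zero occurs, and so that no lower parameter of any ${}_{n+1}F_n$, for any $\kappa$, is a non-positive integer.
   Context: Branch convention: in (i), $\zeta^{1/q}$, $[(-1)^qn^n/(p^pq^q)]^{1/q}$ and $\beta$ may be chosen arbitrarily subject to $\zeta^{1/q}=[(-1)^qn^n/(p^pq^q)]^{1/q}\,g^{-n/q}\beta$; in (ii), similarly, subject to $\zeta^{-1/n}=[(-1)^qn^n/(p^pq^q)]^{-1/n}\,\beta^{-q/n}g$. Here $g^{1/q}$ and $\beta^{1/n}$ are positive real roots, and the complex powers $[\varepsilon_q^{j-1}g^{-1/q}x_j]^{-qa}$, $[\varepsilon_n^{j-1}\beta^{-1/n}x_j]^{-na}$ are principal (their bases are near $1$). Notation: ${}_{m}F_{m-1}(a_1,\dots,a_m;b_1,\dots,b_{m-1};\zeta)=\sum_{k\ge0}\frac{(a_1)_k\cdots(a_m)_k}{(b_1)_k\cdots(b_{m-1})_k(1)_k}\zeta^k$. For $c\in\mathbb{C}$, $(c)_r=c(c+1)\cdots(c+r-1)$ for $r\ge0$ and $(c)_{-s}=[(c-s)\cdots(c-1)]^{-1}$ for $s\ge0$. The constraint ''no division by zero'' includes that the functions $G_\ell$ that appear are well defined. *)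

(* Defs.v *)
From Stdlib Require Export Reals ZArith List Arith.
From Coquelicot Require Export Coquelicot.
Export ListNotations.
Open Scope C_scope.

(* Together with Coquelicot's RtoC, this lets natural numbers and real numbers
   occur directly in complex expressions. *)
Coercion INR : nat >-> R.

Definition Cexp (z : C) : C :=
  RtoC (exp (Re z)) * (cos (Im z), sin (Im z)).

(* The argument in (-PI, PI]; the junk value at 0 is 0. *)
Definition Carg (z : C) : R :=
  let (x, y) := z in
  if Rlt_dec 0 x then atan (y / x)
  else if Rlt_dec x 0 then
    if Rle_dec 0 y then (atan (y / x) + PI)%R else (atan (y / x) - PI)%R
  else if Rlt_dec 0 y then (PI / 2)%R
  else if Rlt_dec y 0 then (- (PI / 2))%R
  else 0%R.

Definition Clog (z : C) : C := (ln (Cmod z), Carg z).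

Definition principal_pow (z w : C) : C := Cexp (w * Clog z).

Definition eps (r : nat) : C := Cexp (RtoC (2 * PI) * Ci / r).

Fixpoint poch (c : C) (r : nat) : C :=
  match r with
  | O => 1
  | S r' => poch c r' * (c + r')
  end.

Definition pochZ (c : C) (m : Z) : C :=
  match m with
  | Zneg s => / poch (c - Pos.to_nat s) (Pos.to_nat s)
  | _ => poch c (Z.to_nat m)
  end.

(* No factor of [(c-s)...(c-1)] vanishes when [m = -s]; void when [m >= 0]. *)
Definition pochZ_defined (c : C) (m : Z) : Prop :=
  forall i : nat, (1 <= i <= Z.to_nat (- m))%nat -> c - i <> 0.

(* Convergence of a complex series amounts to that of its real and imaginary
   parts; Coquelicot's Series is only available over the reals. *)
Definition CSeries (u : nat -> C) : C :=
  (Series (fun k => Re (u k)), Series (fun k => Im (u k))).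

Definition Cprod (s : list C) : C := fold_right Cmult 1 s.

Definition hyp (upper lower : list C) (z : C) : C :=
  CSeries (fun k =>
    Cprod (map (fun b => poch b k) upper)
      / (Cprod (map (fun b => poch b k) lower) * poch 1 k) * z ^ k).

Definition nonpos_int (b : C) : Prop := exists m : nat, b = - m.

Definition lower_ok (lower : list C) : Prop :=
  forall b, In b lower -> ~ nonpos_int b.

Definition G_lower (l : nat) (A B D : C) : list C :=
  match l with
  | O => [(A + D) / B + 1]
  | _ => [(A + D + 1) / B + 1; (A + 1) / (B - 1)]
  end.

(* [l] is only ever 0 or 1. *)
Definition G (l : nat) (A B D y : C) : C :=
  match l with
  | O => hyp [D; RtoC 1] (G_lower 0 A B D) ((y - 1) / y)
  | _ => y / ((1 - B) * y + B)
         * hyp [D; (A + 1) / (B - 1) + 1; RtoC 1] (G_lower 1 A B D) ((y - 1) / y)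
  end.

Definition disc (p q : nat) : C :=
  let n := (p + q)%nat in (- (1)) ^ q * n ^ n / (p ^ p * q ^ q).

Definition upper_zero (p q l : nat) (a c : C) (k : nat) : list C :=
  let n := (p + q)%nat in
  map (fun i : nat => (a + i) / n + k / q) (seq 0 n)
  ++ [(a + c - l) / p + k / q].

Definition lower_zero (p q l : nat) (a c : C) (k : nat) : list C :=
  map (fun i : nat => (a - l + i) / p + k / q) (seq 0 p)
  ++ map (fun i : nat => i / q + k / q)
       (filter (fun i => negb (i =? q - k)%nat) (seq 1 q))
  ++ [(a + c - l + p) / p + k / q].

Definition upper_infty (p q l : nat) (a c : C) (k : nat) : list C :=
  let n := (p + q)%nat in
  map (fun i : nat => (- a + l + i) / p + k / n) (seq 1 p)
  ++ map (fun i : nat => (a + i) / q + k / n) (seq 0 q)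
  ++ [(- a - c + l) / p + k / n].

Definition lower_infty (p q l : nat) (a c : C) (k : nat) : list C :=
  let n := (p + q)%nat in
  map (fun i : nat => i / n + k / n)
       (filter (fun i => negb (i =? n - k)%nat) (seq 1 n))
  ++ [(- a - c + l + p) / p + k / n].

Definition admissible_zero (p q l : nat) (a c : C) : Prop :=
  let n := (p + q)%nat in
  pochZ_defined a (- Z.of_nat l)
  /\ a + c - l <> 0
  /\ lower_ok (G_lower l (- a) (- (p / q)) (- c))
  /\ forall k : nat, (k < q)%nat ->
       pochZ_defined (a + n * k / q) (- Z.of_nat l - Z.of_nat k)
       /\ lower_ok (lower_zero p q l a c k).

Definition admissible_infty (p q l : nat) (a c : C) : Prop :=
  let n := (p + q)%nat in
  pochZ_defined a (- Z.of_nat l)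
  /\ a + c - l <> 0
  /\ lower_ok (G_lower l (- a) (p / n) (- c))
  /\ forall k : nat, (k < n)%nat ->
       pochZ_defined (a + q * k / n) (- Z.of_nat l - Z.of_nat k)
       /\ lower_ok (lower_infty p q l a c k).

Definition root_near (n p : nat) (g beta center : C) (r : R) (x : C) : Prop :=
  (Cmod (x - center) < r)%R /\ x ^ n - g * x ^ p - beta = 0.

(* Main.v *)
Require Import Defs.
From Stdlib Require Import Lra Lia Psatz.

(** Rescaling the roots to u near 1, the trinomial equation becomes
    (1 - u^(-N)) u^e = s with (N, e) = (q, n) in (i) and (n, q) in (ii), where
    s = w^(j-1) t for a primitive N-th root of unity w and t a multiple of beta
    in (i), of g in (ii). Put v = 1 - u^(-N) and 1 + beta = e/N. Expanding
    each s^m = v^m (1 - v)^(-(1 + beta) m) times (1 - v)^(-a) by the binomial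
    series and regrouping by powers of v turns a series in s into one in v, whose
    coefficients are finite differences evaluated by partial fractions; they are
    those of G_l, so that u^(-Na) G_l(..; u^N) is an explicit power series
    sum_m f_m s^m. Averaging over the N-th roots of unity keeps the terms with
    m = k mod N, and Gauss's multiplication formula recognises
    sum_r f_(k+Nr) t^(k+Nr) as the (n+1)Fn series. *)

Local Arguments INR : simpl never.

(** Lagrange inversion is never invoked. For each [u] near 1 the number [s] is computed from [u], so
    the expansion in powers of [s] is an identity between two convergent series, and no analytic
    dependence of the root on [beta] or [g] is at stake; existence and uniqueness of the roots come
    separately, from a contraction. The price is one exchange of summation, paid by a crude
    geometric domination: all coefficients grow at most exponentially, and [v] is taken small enough
    to absorb the growth. The case l = 1 resists the finite-difference argument, because the
    polynomial under the N-th difference then has degree N + 1; multiplying the series by 1 + beta v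
    combines consecutive coefficients and removes the excess, and 1/(1 + beta v) is exactly the
    rational prefactor of G_1. Principal powers occur only at points near 1, where log(u^(-N)) = -N
    log u holds. Coprimality of p and q makes the e-th power of exp(2 pi i/N) a primitive N-th root
    of unity, so that the N branches separate all residues. *)

Lemma INRC_0 : RtoC 0%nat = 0.
Proof. reflexivity. Qed.

Lemma INRC_S (n : nat) : RtoC (S n) = n + 1.
Proof. now rewrite S_INR, RtoC_plus. Qed.

Lemma INRC_add (m n : nat) : RtoC (m + n)%nat = m + n.
Proof. now rewrite plus_INR, RtoC_plus. Qed.

Lemma INRC_mul (m n : nat) : RtoC (m * n)%nat = m * n.
Proof. now rewrite mult_INR, RtoC_mult. Qed.

Lemma INRC_neq_0 (n : nat) : (0 < n)%nat -> RtoC n <> 0.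
Proof. intros H E. apply RtoC_inj in E. apply lt_0_INR in H. lra. Qed.

(** * Finite sums and convergent series of complex numbers *)

Fixpoint csum (u : nat -> C) (n : nat) : C :=
  match n with
  | O => 0
  | S m => csum u m + u m
  end.

Lemma csum_ext (u v : nat -> C) (n : nat) :
  (forall k, (k < n)%nat -> u k = v k) -> csum u n = csum v n.
Proof.
  induction n as [|n IH]; intros H; [reflexivity|simpl].
  rewrite IH, H; auto with arith.
Qed.

Lemma csum_plus (u v : nat -> C) (n : nat) :
  csum (fun k => u k + v k) n = csum u n + csum v n.
Proof. induction n as [|n IH]; simpl; [|rewrite IH]; ring. Qed.

Lemma csum_scal (c : C) (u : nat -> C) (n : nat) :
  csum (fun k => c * u k) n = c * csum u n.
Proof. induction n as [|n IH]; simpl; [|rewrite IH]; ring. Qed.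

Lemma csum_0 (n : nat) : csum (fun _ => 0) n = 0.
Proof. induction n as [|n IH]; simpl; [|rewrite IH]; ring. Qed.

Lemma csum_add (u : nat -> C) (m n : nat) :
  csum u (m + n) = csum u m + csum (fun k => u (m + k)%nat) n.
Proof.
  induction n as [|n IH]; simpl.
  - rewrite Nat.add_0_r. ring.
  - rewrite Nat.add_succ_r. simpl. rewrite IH. ring.
Qed.

Lemma csum_S_l (u : nat -> C) (n : nat) :
  csum u (S n) = u O + csum (fun k => u (S k)) n.
Proof. change (S n) with (1 + n)%nat. rewrite csum_add. simpl. ring. Qed.

Lemma csum_mul (u : nat -> C) (N m : nat) :
  csum u (N * m) = csum (fun r => csum (fun i => u (N * r + i)%nat) N) m.
Proof.
  induction m as [|m IH]; simpl.
  - now rewrite Nat.mul_0_r.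
  - rewrite Nat.mul_succ_r, csum_add, IH. reflexivity.
Qed.

(** Both sides run over the pairs with m + j < n, by diagonals on the left and by rows on the right;
    a step of the induction adds the diagonal m + j = n. *)
Lemma csum_triangle (u : nat -> nat -> C) (n : nat) :
  csum (fun N => csum (fun m => u m (N - m)%nat) (S N)) n
  = csum (fun m => csum (u m) (n - m)) n.
Proof.
  induction n as [|n IH]; [reflexivity|].
  change (csum (fun N => csum (fun m => u m (N - m)%nat) (S N)) n
          + csum (fun m => u m (n - m)%nat) (S n)
          = csum (fun m => csum (u m) (S n - m)) n + csum (u n) (S n - n)).
  rewrite IH.
  replace (S n - n)%nat with 1%nat by lia.
  change (csum (u n) 1) with (0 + u n O).
  change (csum (fun m => u m (n - m)%nat) (S n))
    with (csum (fun m => u m (n - m)%nat) n + u n (n - n)%nat).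
  rewrite Nat.sub_diag.
  assert (H : csum (fun m => csum (u m) (S n - m)) n
              = csum (fun m => csum (u m) (n - m)) n
                + csum (fun m => u m (n - m)%nat) n).
  { rewrite <- csum_plus. apply csum_ext. intros k Hk.
    replace (S n - k)%nat with (S (n - k)) by lia. reflexivity. }
  rewrite H. ring.
Qed.

Lemma half_pow_pos (n : nat) : (0 < (/2) ^ n)%R.
Proof. apply pow_lt. lra. Qed.

Lemma Cmod_csum_geom (u : nat -> C) (K : R) (n : nat) :
  (forall k, (Cmod (u k) <= K * (/2) ^ k)%R) ->
  (Cmod (csum u n) <= 2 * K * (1 - (/2) ^ n))%R.
Proof.
  intros H. induction n as [|n IH]; simpl.
  - rewrite Cmod_0. lra.
  - eapply Rle_trans; [apply Cmod_triangle|]. specialize (H n). lra.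
Qed.

(** The distance to the limit is a real sequence, so complex limits reduce to squeezing against real
    null sequences. *)
Definition conv (u : nat -> C) (s : C) : Prop :=
  is_lim_seq (fun n => Cmod (csum u n - s)) 0.

Lemma squeeze_0 (u v : nat -> R) :
  (forall n, (0 <= u n <= v n)%R) -> is_lim_seq v 0 -> is_lim_seq u 0.
Proof.
  intros H Hv. apply is_lim_seq_le_le with (fun _ => 0%R) v; auto.
  apply is_lim_seq_const.
Qed.

Lemma Cmod_zero_of_lim (z : C) (v : nat -> R) :
  (forall n, (Cmod z <= v n)%R) -> is_lim_seq v 0 -> z = 0.
Proof.
  intros H Hv. apply Cmod_eq_0. apply Rle_antisym; [|apply Cmod_ge_0].
  assert (HL := is_lim_seq_le (fun _ => Cmod z) v (Cmod z) 0 H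
                  (is_lim_seq_const _) Hv).
  exact HL.
Qed.

Lemma lim_seq_plus_0 (u v : nat -> R) :
  is_lim_seq u 0 -> is_lim_seq v 0 -> is_lim_seq (fun n => u n + v n)%R 0.
Proof.
  intros Hu Hv. replace (Finite 0) with (Rbar_plus 0 0) by (simpl; f_equal; ring).
  apply is_lim_seq_plus with 0%R 0%R; auto. reflexivity.
Qed.

Lemma lim_seq_scal_0 (c : R) (u : nat -> R) :
  is_lim_seq u 0 -> is_lim_seq (fun n => c * u n)%R 0.
Proof.
  intros Hu. replace (Finite 0) with (Rbar_mult c 0) by (simpl; f_equal; ring).
  now apply is_lim_seq_scal_l.
Qed.

Lemma lim_half_pow : is_lim_seq (fun n => (/2) ^ n)%R 0.
Proof. apply is_lim_seq_geom. rewrite Rabs_pos_eq; lra. Qed.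

Lemma conv_ext (u v : nat -> C) (s : C) :
  (forall k, u k = v k) -> conv u s -> conv v s.
Proof.
  intros H. apply is_lim_seq_ext. intros n. f_equal. f_equal.
  apply csum_ext. auto.
Qed.

Lemma conv_unique (u : nat -> C) (s t : C) : conv u s -> conv u t -> s = t.
Proof.
  intros Hs Ht. apply Ceq_minus.
  apply Cmod_zero_of_lim with (2 := lim_seq_plus_0 _ _ Hs Ht).
  intros n. replace (s - t) with (- (csum u n - s) + (csum u n - t)) by ring.
  eapply Rle_trans; [apply Cmod_triangle|]. rewrite Cmod_opp. lra.
Qed.

Lemma conv_plus (u v : nat -> C) (s t : C) :
  conv u s -> conv v t -> conv (fun k => u k + v k) (s + t).
Proof.
  intros Hs Ht. apply squeeze_0 with (2 := lim_seq_plus_0 _ _ Hs Ht).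
  intros n. split; [apply Cmod_ge_0|]. rewrite csum_plus.
  replace (csum u n + csum v n - (s + t))
    with ((csum u n - s) + (csum v n - t)) by ring.
  apply Cmod_triangle.
Qed.

Lemma conv_scal (c : C) (u : nat -> C) (s : C) :
  conv u s -> conv (fun k => c * u k) (c * s).
Proof.
  intros Hs. eapply is_lim_seq_ext; [|apply (lim_seq_scal_0 (Cmod c) _ Hs)].
  intros n. simpl. rewrite csum_scal, <- Cmod_mult. f_equal. ring.
Qed.

Lemma conv_csum (u : nat -> nat -> C) (s : nat -> C) (N : nat) :
  (forall j, (j < N)%nat -> conv (u j) (s j)) ->
  conv (fun m => csum (fun j => u j m) N) (csum s N).
Proof.
  induction N as [|N IH]; intros H; simpl.
  - apply is_lim_seq_ext with (fun _ => 0%R); [|apply is_lim_seq_const].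
    intros n. rewrite csum_0.
    replace (0 - 0) with (RtoC 0) by ring. now rewrite Cmod_0.
  - apply (conv_plus (fun m => csum (fun j => u j m) N) (u N)); auto with arith.
Qed.

(** Grouping terms into blocks of N only passes to a subsequence of the partial sums, so no absolute
    convergence is required. *)
Lemma conv_mul_index (u : nat -> C) (s : C) (N : nat) : (0 < N)%nat ->
  conv u s -> conv (fun r => csum (fun i => u (N * r + i)%nat) N) s.
Proof.
  intros HN H.
  apply is_lim_seq_ext with (fun m => Cmod (csum u (N * m) - s)).
  - intros m. now rewrite csum_mul.
  - apply (is_lim_seq_subseq (fun n => Cmod (csum u n - s)) 0 (fun m => (N * m)%nat));
      [|exact H].
    apply eventually_subseq. intros n. nia.
Qed.

(** The shift arises because [sum_n _ n] includes the index [n] while [csum _ n] stops before it. *)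
Lemma csum_parts (u : nat -> C) (n : nat) :
  csum u (S n) = (sum_n (fun k => Re (u k)) n, sum_n (fun k => Im (u k)) n).
Proof.
  induction n as [|n IH].
  - rewrite !sum_O. simpl. rewrite Cplus_0_l. now destruct (u O).
  - change (csum u (S (S n))) with (csum u (S n) + u (S n)). rewrite IH, !sum_Sn.
    destruct (u (S n)) as [x y]. reflexivity.
Qed.

Lemma conv_of_parts (u : nat -> C) (s : C) :
  is_series (fun k => Re (u k)) (Re s) -> is_series (fun k => Im (u k)) (Im s) ->
  conv u s.
Proof.
  intros H1 H2.
  apply is_lim_seq_incr_1.
  assert (L : forall (v : nat -> R) (t : R), is_series v t ->
            is_lim_seq (fun n => Rabs (sum_n v n - t)) 0).
  { intros v t Hv. assert (Hv' : is_lim_seq (sum_n v) t) by exact Hv.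
    assert (D := is_lim_seq_minus' _ _ _ _ Hv' (is_lim_seq_const t)).
    apply (is_lim_seq_abs _ _) in D. simpl in D.
    replace (Rabs (t - t)) with 0%R in D; [exact D|].
    rewrite Rminus_diag, Rabs_R0. reflexivity. }
  apply squeeze_0 with (2 := lim_seq_plus_0 _ _ (L _ _ H1) (L _ _ H2)).
  intros n. split; [apply Cmod_ge_0|]. rewrite csum_parts.
  destruct s as [a b]. unfold Cmod, Cminus, Cplus, Copp. simpl fst. simpl snd. simpl Re. simpl Im.
  set (x := sum_n _ n). set (y := sum_n _ n).
  unfold Rminus. set (X := (x + - a)%R). set (Y := (y + - b)%R).
  apply Rsqr_incr_0_var; [|assert (HX := Rabs_pos X); assert (HY := Rabs_pos Y); lra].
  unfold Rsqr. rewrite sqrt_sqrt; [|nra].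
  assert (HX := Rabs_pos X); assert (HY := Rabs_pos Y).
  rewrite <- (pow2_abs X), <- (pow2_abs Y). nra.
Qed.

Lemma im_le_Cmod (z : C) : (Rabs (Im z) <= Cmod z)%R.
Proof. eapply Rle_trans; [|apply Rmax_Cmod]. apply Rmax_r. Qed.

(** [Series] is total and meaningful only on convergent series; this is the single passage from
    [conv] to the values of [hyp]. *)
Lemma conv_CSeries (u : nat -> C) (s : C) : conv u s -> CSeries u = s.
Proof.
  intros H. unfold CSeries.
  apply is_lim_seq_incr_1 in H.
  assert (L : forall (v : nat -> R) (t : R),
     (forall n, Rabs (sum_n v n - t) <= Cmod (csum u (S n) - s))%R -> is_series v t).
  { intros v t Hv.
    assert (D : is_lim_seq (fun n => sum_n v n - t)%R 0).
    { apply is_lim_seq_abs_0. apply squeeze_0 with (2 := H).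
      intros n. split; [apply Rabs_pos|apply Hv]. }
    assert (D' := is_lim_seq_plus' _ _ _ _ D (is_lim_seq_const t)).
    rewrite Rplus_0_l in D'.
    assert (D2 : is_lim_seq (sum_n v) t); [|exact D2].
    eapply is_lim_seq_ext; [|exact D']. intros n. simpl. ring. }
  rewrite (is_series_unique _ (Re s)), (is_series_unique _ (Im s)).
  - now destruct s.
  - apply L. intros n. rewrite csum_parts.
    eapply Rle_trans; [|apply im_le_Cmod]. destruct s. apply Req_le. reflexivity.
  - apply L. intros n. rewrite csum_parts.
    eapply Rle_trans; [|apply re_le_Cmod]. destruct s. apply Req_le. reflexivity.
Qed.

Lemma conv_geom (u : nat -> C) (K : R) :
  (forall k, (Cmod (u k) <= K * (/2) ^ k)%R) ->
  exists s, conv u s.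
Proof.
  intros H.
  assert (G : ex_series (fun k => K * (/2) ^ k)%R).
  { apply (ex_series_scal_l K (fun k => (/2) ^ k)%R). apply ex_series_geom.
    rewrite Rabs_pos_eq; lra. }
  assert (H1 : ex_series (fun k => Re (u k))).
  { apply (ex_series_le (V := R_CompleteNormedModule) _ _ ) with (2 := G). intros n.
    eapply Rle_trans; [apply re_le_Cmod|apply H]. }
  assert (H2 : ex_series (fun k => Im (u k))).
  { apply (ex_series_le (V := R_CompleteNormedModule) _ _ ) with (2 := G). intros n.
    eapply Rle_trans; [apply im_le_Cmod|apply H]. }
  destruct H1 as [x Hx]. destruct H2 as [y Hy]. exists (x, y).
  now apply conv_of_parts.
Qed.

Lemma conv_geom_tail (u : nat -> C) (K : R) (s : C) :
  (forall k, (Cmod (u k) <= K * (/2) ^ k)%R) -> conv u s ->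
  forall n, (Cmod (s - csum u n) <= 2 * K * (/2) ^ n)%R.
Proof.
  intros H Hs n.
  assert (HK : (0 <= K)%R).
  { specialize (H O). simpl in H. assert (P := Cmod_ge_0 (u O)). lra. }
  (* The block of indices from n to d + n is bounded uniformly in d; letting d tend to infinity then
     removes the remainder. *)
  assert (T : forall d, (Cmod (s - csum u n) <=
            2 * K * (/2) ^ n + Cmod (csum u (d + n) - s))%R).
  { intros d.
    replace (s - csum u n) with (- (csum u (d + n) - s)
         + csum (fun k => u (n + k)%nat) d)
      by (rewrite (Nat.add_comm d n), csum_add; ring).
    eapply Rle_trans; [apply Cmod_triangle|]. rewrite Cmod_opp.
    assert (B := Cmod_csum_geom (fun k => u (n + k)%nat) (K * (/2) ^ n) d).
    assert (P := half_pow_pos d). assert (P' := half_pow_pos n).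
    assert (Cmod (csum (fun k => u (n + k)%nat) d)
            <= 2 * (K * (/ 2) ^ n) * (1 - (/ 2) ^ d))%R.
    { apply B. intros k. eapply Rle_trans; [apply H|]. rewrite pow_add.
      apply Req_le. ring. }
    assert (0 <= K * (/2) ^ n)%R by nra. nra. }
  assert (L : is_lim_seq (fun d => 2 * K * (/2) ^ n + Cmod (csum u (d + n) - s))%R
               (2 * K * (/2) ^ n + 0)%R).
  { apply is_lim_seq_plus'; [apply is_lim_seq_const|].
    now apply (is_lim_seq_incr_n (fun m => Cmod (csum u m - s)) n). }
  rewrite Rplus_0_r in L.
  assert (HL := is_lim_seq_le (fun _ => Cmod (s - csum u n)) _
     (Cmod (s - csum u n)) _ T (is_lim_seq_const _) L).
  exact HL.
Qed.

(** The extra factor [(/2) ^ m] makes the N + 1 terms of the N-th diagonal sum to at most 2 K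
    2^(-N), without a factor N + 1. *)
Lemma conv_diagonals (t : nat -> nat -> C) (K : R) :
  (forall m j, (Cmod (t m j) <= K * ((/2) ^ m * (/2) ^ j) * (/2) ^ m)%R) ->
  exists s, conv (fun N => csum (fun m => t m (N - m)%nat) (S N)) s.
Proof.
  intros H.
  assert (HK : (0 <= K)%R).
  { specialize (H O O). simpl in H. assert (P := Cmod_ge_0 (t O O)). lra. }
  apply (conv_geom _ (2 * K)). intros N.
  eapply Rle_trans; [apply (Cmod_csum_geom _ (K * (/2) ^ N))|].
  - intros m. eapply Rle_trans; [apply H|].
    apply Rmult_le_compat_r; [apply Rlt_le, half_pow_pos|].
    apply Rmult_le_compat_l; [assumption|].
    (* [Cmod_csum_geom] asks for the bound at every m, also beyond N, where the truncated difference
       N - m is 0. *)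
    rewrite <- pow_add. replace (m + (N - m))%nat with (N + (m - N))%nat by lia.
    rewrite pow_add. assert (P := half_pow_pos N).
    assert (Q : ((/2) ^ (m - N) <= 1)%R).
    { rewrite <- (pow1 (m - N)). apply pow_incr. lra. }
    apply Rmult_le_compat_l with (r := ((/2) ^ N)%R) in Q; lra.
  - assert (P := half_pow_pos N). assert (P' := half_pow_pos (S N)).
    assert (0 <= K * (/2) ^ N)%R by (apply Rmult_le_pos; lra). nra.
Qed.

(* Both the rows and the diagonals of a geometrically dominated double series
   exhaust it, so the row sums and the diagonal sums have the same total. *)
Lemma conv_rows_diagonals (t : nat -> nat -> C) (K : R) (row : nat -> C) (s : C) :
  (forall m j, (Cmod (t m j) <= K * ((/2) ^ m * (/2) ^ j) * (/2) ^ m)%R) ->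
  (forall m, conv (t m) (row m)) ->
  conv (fun N => csum (fun m => t m (N - m)%nat) (S N)) s ->
  conv row s.
Proof.
  intros H Hrow Hs.
  assert (HK : (0 <= K)%R).
  { specialize (H O O). simpl in H. assert (P := Cmod_ge_0 (t O O)). lra. }
  assert (D : forall n, (Cmod (csum row n - csum (fun m => csum (t m) (n - m)) n)
            <= 4 * K * (/2) ^ n)%R).
  { intros n.
    replace (csum row n - csum (fun m => csum (t m) (n - m)) n)
      with (csum (fun m => row m - csum (t m) (n - m)) n).
    2:{ replace (csum row n - csum (fun m => csum (t m) (n - m)) n)
         with (csum row n + (-1) * csum (fun m => csum (t m) (n - m)) n) by ring.
        rewrite <- csum_scal, <- csum_plus. apply csum_ext. intros. ring. }
    (* Row r loses its tail from n - r on, of modulus at most 2 K 2^(-n) 2^(-r); the second factor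
       makes the total over all rows O(2^(-n)). *)
    assert (B : forall r, (r <= n)%nat ->
      (Cmod (csum (fun m => (row m - csum (t m) (n - m))%C) r)
        <= 2 * (2 * K * (/2) ^ n) * (1 - (/2) ^ r))%R).
    { induction r as [|r IH]; intros Hr; simpl csum.
      - rewrite Cmod_0. simpl. lra.
      - eapply Rle_trans; [apply Cmod_triangle|].
        assert (IH' := IH ltac:(lia)).
        assert (T := conv_geom_tail (t r) (K * (/2) ^ r * (/2) ^ r) (row r)).
        assert (Cmod (row r - csum (t r) (n - r))
           <= 2 * (K * (/2) ^ r * (/2) ^ r) * (/2) ^ (n - r))%R.
        { apply T; auto. intros k. eapply Rle_trans; [apply H|]. apply Req_le. ring. }
        assert (E : ((/2) ^ n = (/2) ^ r * (/2) ^ (n - r))%R)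
          by (rewrite <- pow_add; f_equal; lia).
        rewrite E in *. simpl pow. lra. }
    eapply Rle_trans; [apply B; lia|].
    assert (P := half_pow_pos n). assert (0 <= K * (/2) ^ n)%R by nra. nra. }
  unfold conv in *.
  assert (HL := lim_seq_plus_0 _ _ (lim_seq_scal_0 (4 * K) _ lim_half_pow) Hs).
  apply squeeze_0 with (2 := HL). intros n. split; [apply Cmod_ge_0|].
  rewrite csum_triangle.
  specialize (D n).
  set (A := csum (fun m => csum (t m) (n - m)) n) in *.
  replace (csum row n - s) with ((csum row n - A) + (A - s)) by ring.
  eapply Rle_trans; [apply Cmod_triangle|]. lra.
Qed.

(** * Pochhammer symbols *)

Lemma poch_S_l (z : C) (n : nat) : poch z (S n) = z * poch (z + 1) n.
Proof.
  induction n as [|n IH].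
  - simpl. rewrite INRC_0. ring.
  - change (poch z (S (S n))) with (poch z (S n) * (z + S n)).
    rewrite IH. simpl poch. rewrite INRC_S. ring.
Qed.

Lemma poch_add (z : C) (m n : nat) : poch z (m + n) = poch z m * poch (z + m) n.
Proof.
  induction n as [|n IH].
  - rewrite Nat.add_0_r. simpl. ring.
  - rewrite Nat.add_succ_r. simpl. rewrite IH, INRC_add. ring.
Qed.

Lemma poch_neq_0 (z : C) (n : nat) :
  (forall i, (i < n)%nat -> z + i <> 0) -> poch z n <> 0.
Proof.
  induction n as [|n IH]; intros H; simpl.
  - exact C1_nz.
  - apply Cmult_neq_0; auto with arith.
Qed.

Lemma fact_poch_neq_0 (n : nat) : poch 1 n <> 0.
Proof.
  apply poch_neq_0. intros i _. rewrite Cplus_comm, <- INRC_S.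
  apply INRC_neq_0. lia.
Qed.

Lemma poch_one_S (n : nat) : poch 1 (S n) = S n * poch 1 n.
Proof. simpl. rewrite INRC_S. ring. Qed.

(** * Alternating binomial sums *)

(* [altsum N f] is the N-th finite difference of [f] at 0, up to [(-1)^N / N!]. *)
Definition altsum (N : nat) (f : nat -> C) : C :=
  csum (fun m => (- (1)) ^ m / (poch 1 m * poch 1 (N - m)) * f m) (S N).

Lemma altsum_ext (N : nat) (f g : nat -> C) :
  (forall m, (m <= N)%nat -> f m = g m) -> altsum N f = altsum N g.
Proof. intros H. apply csum_ext. intros k Hk. rewrite H; auto with arith. Qed.

Lemma altsum_plus (N : nat) (f g : nat -> C) :
  altsum N (fun m => f m + g m) = altsum N f + altsum N g.
Proof. unfold altsum. rewrite <- csum_plus. apply csum_ext. intros. ring. Qed.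

Lemma altsum_scal (N : nat) (c : C) (f : nat -> C) :
  altsum N (fun m => c * f m) = c * altsum N f.
Proof. unfold altsum. rewrite <- csum_scal. apply csum_ext. intros. ring. Qed.

(** Since m/m! = 1/(m-1)!, a weight m shifts the argument and lowers the order of the difference by
    one. *)
Lemma altsum_weight_l (N : nat) (f : nat -> C) :
  altsum (S N) (fun m => m * f m) = - altsum N (fun m => f (S m)).
Proof.
  unfold altsum. rewrite csum_S_l.
  replace (- csum (fun m => (- (1)) ^ m / (poch 1 m * poch 1 (N - m)) * f (S m)) (S N))
    with ((-1) * csum (fun m => (- (1)) ^ m / (poch 1 m * poch 1 (N - m)) * f (S m)) (S N))
    by ring.
  rewrite <- csum_scal. change (RtoC (INR 0)) with (RtoC 0).
  rewrite Cmult_0_l, Cmult_0_r, Cplus_0_l.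
  apply csum_ext. intros m Hm.
  replace (S N - S m)%nat with (N - m)%nat by lia.
  rewrite poch_one_S, Cpow_S. field.
  repeat split; try apply fact_poch_neq_0. apply INRC_neq_0. lia.
Qed.

Lemma altsum_weight_r (N : nat) (f : nat -> C) :
  altsum (S N) (fun m => (S N - m) * f m) = altsum N f.
Proof.
  unfold altsum.
  change (csum (fun m => (- (1)) ^ m / (poch 1 m * poch 1 (S N - m)) * ((S N - m) * f m)) (S (S N)))
    with (csum (fun m => (- (1)) ^ m / (poch 1 m * poch 1 (S N - m)) * ((S N - m) * f m)) (S N)
     + (- (1)) ^ S N / (poch 1 (S N) * poch 1 (S N - S N)) * ((S N - S N) * f (S N))).
  replace ((RtoC (S N) - S N) * f (S N)) with (RtoC 0) by ring.
  rewrite Cmult_0_r, Cplus_0_r.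
  apply csum_ext. intros m Hm.
  replace (S N - m)%nat with (S (N - m)) by lia.
  replace (RtoC (S N) - m) with (RtoC (S (N - m))).
  - rewrite poch_one_S. field.
    repeat split; try apply fact_poch_neq_0. apply INRC_neq_0. lia.
  - rewrite <- RtoC_minus, <- minus_INR by lia. do 2 f_equal. lia.
Qed.

(** Writing S N = (S N - m) + m lets each summand cancel one of the two factorials; this recurrence
    drives the inductions on the order. *)
Lemma altsum_S (N : nat) (f : nat -> C) :
  S N * altsum (S N) f = altsum N f - altsum N (fun m => f (S m)).
Proof.
  rewrite <- (altsum_weight_r N f).
  replace (altsum (S N) (fun m => (S N - m) * f m) - altsum N (fun m => f (S m)))
    with (altsum (S N) (fun m => (S N - m) * f m) + - altsum N (fun m => f (S m)))
    by ring.
  rewrite <- (altsum_weight_l N f), <- altsum_plus, <- altsum_scal.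
  apply altsum_ext. intros. ring.
Qed.

(** An N-th difference kills polynomials of degree below N. The last factor of the symbol is peeled
    off; its part beta m lowers the order and replaces w by w + beta, which is why w is quantified
    inside the induction. *)
Lemma altsum_poch (beta : C) (r : nat) : forall (N : nat) (w : C), (r < N)%nat ->
  altsum N (fun m => poch (w + beta * m) r) = 0.
Proof.
  induction r as [|r IH]; intros N w H; (destruct N as [|N]; [lia|]).
  - assert (HN : RtoC (S N) <> 0) by (apply INRC_neq_0; lia).
    assert (E := altsum_S N (fun _ => 1)).
    replace (altsum N (fun _ => 1) - altsum N (fun _ => 1)) with (RtoC 0) in E by ring.
    change (altsum (S N) (fun _ => 1) = 0).
    replace (altsum (S N) (fun _ => 1))
      with (/ RtoC (S N) * (S N * altsum (S N) (fun _ => 1))) by now field.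
    rewrite E. ring.
  - replace (altsum (S N) (fun m => poch (w + beta * m) (S r)))
      with ((w + r) * altsum (S N) (fun m => poch (w + beta * m) r)
            + beta * altsum (S N) (fun m => m * poch (w + beta * m) r)).
    + rewrite IH by lia. rewrite altsum_weight_l.
      rewrite (altsum_ext N _ (fun m => poch (w + beta + beta * m) r)).
      * rewrite IH by lia. ring.
      * intros m _. f_equal. rewrite INRC_S. ring.
    + rewrite <- !altsum_scal, <- altsum_plus. apply altsum_ext.
      intros m _. simpl. ring.
Qed.

(** Read from right to left, this is the partial fraction decomposition of 1/(x)_(N+1), whose
    residue at -m is (-1)^m/(m! (N-m)!). *)
Lemma altsum_inv (N : nat) : forall x : C,
  (forall m, (m <= N)%nat -> x + m <> 0) ->
  altsum N (fun m => / (x + m)) = / poch x (S N).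
Proof.
  induction N as [|N IH]; intros x H.
  - unfold altsum. specialize (H O (le_n _)). simpl. rewrite INRC_0 in *. field.
    now rewrite Cplus_0_r in *.
  - assert (E := altsum_S N (fun m => / (x + m))). cbv beta in E.
    rewrite (altsum_ext N (fun m => / (x + S m)) (fun m => / (x + 1 + m))) in E.
    2:{ intros m _. rewrite INRC_S. f_equal. ring. }
    rewrite !IH in E; auto.
    2:{ intros m Hm. replace (x + 1 + m) with (x + S m) by (rewrite INRC_S; ring).
        apply H. lia. }
    assert (HN : RtoC (S N) <> 0) by (apply INRC_neq_0; lia).
    replace (altsum (S N) (fun m => / (x + m)))
      with (/ RtoC (S N) * (S N * altsum (S N) (fun m => / (x + m)))) by now field.
    rewrite E.
    assert (E1 : poch x (S (S N)) = x * poch (x + 1) (S N)) by apply poch_S_l.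
    assert (E2 : poch x (S (S N)) = poch x (S N) * (x + S N)) by reflexivity.
    assert (Hx : x <> 0).
    { specialize (H O ltac:(lia)). now rewrite INRC_0, Cplus_0_r in H. }
    assert (HS : x + S N <> 0) by (apply H; lia).
    assert (HP : poch x (S (S N)) <> 0).
    { apply poch_neq_0. intros i Hi. apply H. lia. }
    assert (HQ : poch (x + 1) (S N) <> 0).
    { intros Q. apply HP. rewrite E1, Q. ring. }
    replace (poch x (S N)) with (x * poch (x + 1) (S N) / (x + S N)).
    2:{ rewrite <- E1, E2. field. assumption. }
    rewrite E1. field. auto.
Qed.

(* Partial fractions in [beta * m]: dividing the polynomial [(a)_r] by the linear
   form [E + beta * m] leaves its value at [-E], and the quotient, of degree
   below [N], is killed by the N-th difference. *)
Lemma altsum_poch_div (a E beta : C) (N r : nat) : (r <= N)%nat ->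
  (forall m, (m <= N)%nat -> E + beta * m <> 0) ->
  altsum N (fun m => poch (a + beta * m) r / (E + beta * m))
  = poch (a - E) r * altsum N (fun m => / (E + beta * m)).
Proof.
  intros Hr H. induction r as [|r IH].
  - rewrite <- altsum_scal. apply altsum_ext. intros. simpl. field. auto.
  - rewrite (altsum_ext N _ (fun m =>
       (a - E + r) * (poch (a + beta * m) r / (E + beta * m))
       + poch (a + beta * m) r)).
    + rewrite altsum_plus, altsum_scal, IH, altsum_poch by lia. simpl. ring.
    + intros m Hm. simpl. field. auto.
Qed.

(** The value at the pole is (a - (a + c))_N = (-c)_N, and the numerator a + c cancels the first
    factor of (x)_(N+1) at x = (a + c)/beta. The result is the coefficient of v^N in G_0, where the
    upper parameter 1 cancels N!. *)
Lemma altsum_gauss (a c beta : C) (N : nat) : beta <> 0 ->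
  (forall m, (m <= N)%nat -> a + c + beta * m <> 0) ->
  altsum N (fun m => poch (a + beta * m) N * ((a + c) / (a + c + beta * m)))
  = poch (- c) N / poch ((a + c) / beta + 1) N.
Proof.
  intros Hb H.
  assert (H0 : a + c <> 0).
  { specialize (H O ltac:(lia)). now rewrite INRC_0, Cmult_0_r, Cplus_0_r in H. }
  assert (Hx : forall m, (m <= N)%nat -> (a + c) / beta + m <> 0).
  { intros m Hm Q. apply (H m Hm).
    replace (a + c + beta * m) with (beta * ((a + c) / beta + m)) by now field.
    rewrite Q. ring. }
  rewrite (altsum_ext N _ (fun m => (a + c) * (poch (a + beta * m) N / (a + c + beta * m)))).
  2:{ intros m Hm. field. auto. }
  rewrite altsum_scal, altsum_poch_div by auto.
  rewrite (altsum_ext N (fun m => / (a + c + beta * m))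
            (fun m => / beta * / ((a + c) / beta + m))).
  2:{ intros m Hm. specialize (H m Hm). field. split; auto.
      replace (a + c + m * beta) with (a + c + beta * m) by ring. auto. }
  rewrite altsum_scal, altsum_inv by auto. rewrite poch_S_l.
  replace (a - (a + c)) with (- c) by ring. field.
  split; [|auto]. apply poch_neq_0. intros i Hi.
  replace ((a + c) / beta + 1 + i) with ((a + c) / beta + S i)
    by (rewrite INRC_S; ring). auto.
Qed.

(** With l = 1 the symbol is too long for [altsum_poch_div]. Rewriting the second sum with the
    weight S N - m, the last factors combine to (a + beta m + S N) + beta (S N - m), which does not
    depend on m. *)
Lemma altsum_gauss_step (a E beta : C) (N : nat) :
  (forall m, (m <= S N)%nat -> E + beta * m <> 0) ->
  altsum (S N) (fun m => poch (a + beta * m) (S (S N)) * (E / (E + beta * m)))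
  + beta * altsum N (fun m => poch (a + beta * m) (S N) * (E / (E + beta * m)))
  = (a + S N + S N * beta)
    * altsum (S N) (fun m => poch (a + beta * m) (S N) * (E / (E + beta * m))).
Proof.
  intros H.
  rewrite <- (altsum_weight_r N), <- !altsum_scal, <- altsum_plus.
  apply altsum_ext. intros m Hm.
  change (poch (a + beta * m) (S (S N)))
    with (poch (a + beta * m) (S N) * (a + beta * m + S N)).
  field. auto.
Qed.

(** * The binomial series *)

(** The coefficient of v^j in (1 - v)^(-w). *)
Definition rbin (w : C) (j : nat) : C := poch w j / poch 1 j.

Lemma rbin_0 (w : C) : rbin w 0 = 1.
Proof. unfold rbin. simpl. field. Qed.

Lemma rbin_S (w : C) (j : nat) : S j * rbin w (S j) = (w + j) * rbin w j.
Proof.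
  unfold rbin. rewrite poch_one_S. simpl poch. field. split.
  - apply fact_poch_neq_0.
  - apply INRC_neq_0. lia.
Qed.

Lemma rbin_pascal (w : C) (j : nat) :
  rbin (w + 1) (S j) = rbin (w + 1) j + rbin w (S j).
Proof.
  assert (HS : RtoC (S j) <> 0) by (apply INRC_neq_0; lia).
  assert (HF := fact_poch_neq_0 j).
  unfold rbin. rewrite poch_one_S, (poch_S_l w). simpl poch.
  rewrite INRC_S in *. field. auto.
Qed.

(** For W > 0 this is the binomial coefficient of W + j - 1 over j; the double induction is Pascal's
    rule, the two summands accounting for the doubling. *)
Lemma Cmod_rbin_nat (W : nat) : forall j : nat, (Cmod (rbin W j) <= 2 ^ (W + j))%R.
Proof.
  assert (P2 : forall k, (1 <= 2 ^ k)%R) by (intros k; apply pow_R1_Rle; lra).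
  induction W as [|W IHW]; induction j as [|j IHj].
  - rewrite rbin_0, Cmod_1. apply P2.
  - unfold rbin. rewrite poch_S_l, INRC_0.
    replace (0 * poch (0 + 1) j / poch 1 (S j)) with (RtoC 0).
    + rewrite Cmod_0. specialize (P2 (0 + S j)%nat). lra.
    + field. apply fact_poch_neq_0.
  - rewrite rbin_0, Cmod_1. apply P2.
  - rewrite INRC_S in *. rewrite rbin_pascal.
    eapply Rle_trans; [apply Cmod_triangle|].
    specialize (IHW (S j)). rewrite Nat.add_succ_r in IHW |- *.
    simpl Nat.add in *. simpl pow in *. lra.
Qed.

Lemma Cmod_poch_le (w : C) (W : nat) (j : nat) : (Cmod w <= W)%R ->
  (Cmod (poch w j) <= Cmod (poch W j))%R.
Proof.
  intros H. induction j as [|j IH]; simpl.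
  - lra.
  - rewrite !Cmod_mult. apply Rmult_le_compat; try apply Cmod_ge_0; auto.
    eapply Rle_trans; [apply Cmod_triangle|].
    rewrite <- RtoC_plus, !Cmod_R, <- plus_INR, !Rabs_pos_eq by apply pos_INR.
    rewrite plus_INR. lra.
Qed.

Lemma Cmod_rbin (w : C) (W j : nat) : (Cmod w <= W)%R ->
  (Cmod (rbin w j) <= 2 ^ (W + j))%R.
Proof.
  intros H. eapply Rle_trans; [|apply Cmod_rbin_nat].
  unfold rbin. rewrite !Cmod_div by apply fact_poch_neq_0.
  apply Rmult_le_compat_r; [|now apply Cmod_poch_le].
  apply Rlt_le, Rinv_0_lt_compat, Cmod_gt_0, fact_poch_neq_0.
Qed.

Definition nat_above (x : R) : nat := Z.to_nat (up x).

Lemma nat_above_le (x : R) : (x <= nat_above x)%R.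
Proof.
  unfold nat_above. destruct (archimed x) as [H _].
  destruct (Z.le_ge_cases 0 (up x)) as [Hu|Hu].
  - rewrite INR_IZR_INZ, Z2Nat.id by assumption. lra.
  - apply IZR_le in Hu. assert (P := pos_INR (Z.to_nat (up x))). simpl in Hu. lra.
Qed.

(** * Derivatives along a real parameter, the complex exponential and logarithm *)

Definition cderive (f : R -> C) (t : R) (d : C) : Prop :=
  is_derive (fun s => Re (f s)) t (Re d) /\ is_derive (fun s => Im (f s)) t (Im d).

Lemma cderive_mult (f g : R -> C) (t : R) (df dg : C) :
  cderive f t df -> cderive g t dg ->
  cderive (fun s => f s * g s) t (df * g t + f t * dg).
Proof.
  intros [F1 F2] [G1 G2]. split.
  - evar_last.
    + apply (is_derive_ext (fun s => Re (f s) * Re (g s) - Im (f s) * Im (g s))%R).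
      { intros s. now destruct (f s), (g s). }
      apply @is_derive_minus.
      * exact (Derive.is_derive_mult _ _ _ _ _ F1 G1).
      * exact (Derive.is_derive_mult _ _ _ _ _ F2 G2).
    + destruct df, dg, (f t), (g t). unfold minus, plus, opp, mult; simpl. ring.
  - evar_last.
    + apply (is_derive_ext (fun s => Re (f s) * Im (g s) + Im (f s) * Re (g s))%R).
      { intros s. now destruct (f s), (g s). }
      apply @is_derive_plus.
      * exact (Derive.is_derive_mult _ _ _ _ _ F1 G2).
      * exact (Derive.is_derive_mult _ _ _ _ _ F2 G1).
    + destruct df, dg, (f t), (g t). unfold minus, plus, opp, mult; simpl. ring.
Qed.

Lemma cderive_const (c : C) (t : R) : cderive (fun _ => c) t 0.
Proof. split; apply @is_derive_const. Qed.

Lemma cderive_Cexp (f : R -> C) (t : R) (d : C) :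
  cderive f t d -> cderive (fun s => Cexp (f s)) t (Cexp (f t) * d).
Proof.
  intros [F1 F2].
  assert (H : forall (x y : R -> R) (dx dy : R), is_derive x t dx -> is_derive y t dy ->
     is_derive (fun s => exp (x s) * cos (y s))%R t
       (exp (x t) * (dx * cos (y t) - dy * sin (y t)))%R /\
     is_derive (fun s => exp (x s) * sin (y s))%R t
       (exp (x t) * (dx * sin (y t) + dy * cos (y t)))%R).
  { intros x y dx dy X Y.
    assert (D1 := is_derive_unique _ _ _ X). assert (D2 := is_derive_unique _ _ _ Y).
    assert (X1 : ex_derive x t) by (eexists; eauto).
    assert (X2 : ex_derive y t) by (eexists; eauto).
    split; (auto_derive; [tauto|]; change (fun t => x t) with x;
            change (fun t => y t) with y; rewrite D1, D2; ring). }
  destruct (H _ _ _ _ F1 F2) as [H1 H2]. destruct d as [dx dy]. split.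
  - evar_last.
    + eapply is_derive_ext; [|exact H1]. intros s. simpl. ring.
    + simpl. ring.
  - evar_last.
    + eapply is_derive_ext; [|exact H2]. intros s. simpl. ring.
    + simpl. ring.
Qed.

Lemma cderive_0_const (f : R -> C) :
  (forall t : R, (0 <= t <= 1)%R -> cderive f t 0) -> f 0%R = f 1%R.
Proof.
  intros H.
  assert (E1 : Re (f 0%R) = Re (f 1%R)).
  { apply (eq_is_derive (fun s => Re (f s))); [|lra].
    intros t Ht. apply (H t Ht). }
  assert (E2 : Im (f 0%R) = Im (f 1%R)).
  { apply (eq_is_derive (fun s => Im (f s))); [|lra].
    intros t Ht. apply (H t Ht). }
  destruct (f 0%R), (f 1%R). simpl in *. now subst.
Qed.

Lemma Cexp_0 : Cexp 0 = 1.
Proof. unfold Cexp. simpl. rewrite exp_0, cos_0, sin_0. apply injective_projections; simpl; ring. Qed.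

Lemma Cexp_plus (z w : C) : Cexp (z + w) = Cexp z * Cexp w.
Proof.
  destruct z, w. unfold Cexp. simpl. rewrite exp_plus, cos_plus, sin_plus.
  apply injective_projections; simpl; ring.
Qed.

Lemma Cexp_neq_0 (z : C) : Cexp z <> 0.
Proof.
  intros E. apply C1_nz. rewrite <- Cexp_0.
  replace (RtoC 0) with (z + - z) by ring. rewrite Cexp_plus, E. ring.
Qed.

Lemma Cexp_opp (z : C) : Cexp (- z) = / Cexp z.
Proof.
  assert (E : Cexp (- z) * Cexp z = 1).
  { rewrite <- Cexp_plus. replace (- z + z) with (RtoC 0) by ring. apply Cexp_0. }
  replace (Cexp (- z)) with (Cexp (- z) * Cexp z * / Cexp z)
    by (field; apply Cexp_neq_0).
  rewrite E. ring.
Qed.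

Lemma Cexp_mul_nat (n : nat) (z : C) : Cexp (n * z) = Cexp z ^ n.
Proof.
  induction n as [|n IH].
  - rewrite INRC_0, Cmult_0_l, Cexp_0. reflexivity.
  - rewrite INRC_S, Cpow_S, <- IH, <- Cexp_plus. f_equal. ring.
Qed.

Lemma Cmod_sq_pos (x y : R) : (0 < x)%R -> (0 < x * x + y * y)%R.
Proof. nra. Qed.

(** In the right half-plane the principal logarithm is given by one formula, differentiable as it
    stands; the case distinctions of [Carg] would obstruct differentiation. *)
Lemma cderive_log_segment (v : C) (t : R) : (0 < 1 - t * Re v)%R ->
  cderive (fun s => (ln (Cmod (1 - s * v)), atan (Im (1 - s * v) / Re (1 - s * v)))%R)
    t (- v / (1 - t * v)).
Proof.
  intros H. destruct v as [x y]. simpl Re in H.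
  assert (P := Cmod_sq_pos _ (t * y) H).
  assert (E : - (x, y) / (1 - t * (x, y))
    = (((- x * (1 - t * x) + t * y * y) / ((1 - t * x) * (1 - t * x) + t * y * (t * y)))%R,
       (- y / ((1 - t * x) * (1 - t * x) + t * y * (t * y)))%R)).
  { apply injective_projections; simpl; field; simpl;
      intros Q; apply Rlt_not_eq in P; apply P; rewrite <- Q; ring. }
  rewrite E. split; simpl Re; simpl Im.
  - apply (is_derive_ext
      (fun s => ln (sqrt ((1 - s * x) * (1 - s * x) + s * y * (s * y))))%R).
    { intros s. unfold Cmod. simpl. do 2 f_equal. ring. }
    auto_derive.
    + split; [lra|]. split; [now apply sqrt_lt_R0|exact I].
    + set (X := ((1 + - (t * x)) * (1 + - (t * x)) + t * y * (t * y))%R).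
      replace ((1 - t * x) * (1 - t * x) + t * y * (t * y))%R with X
        by (unfold X; ring).
      assert (PX : (0 < X)%R) by (unfold X; lra).
      assert (Eq := sqrt_sqrt X ltac:(lra)).
      assert (Pq : (0 < sqrt X)%R) by now apply sqrt_lt_R0.
      revert Eq Pq. generalize (sqrt X). intros r Eq Pq. rewrite <- Eq. field. lra.
  - apply (is_derive_ext (fun s => atan (- (s * y) / (1 - s * x))%R)).
    { intros s. simpl. f_equal. f_equal; [ring|ring]. }
    auto_derive; [lra|]. field. split; [lra|].
    replace ((1 - t * x) ^ 2 + (- (t * y)) ^ 2)%R
      with ((1 - t * x) * (1 - t * x) + t * y * (t * y))%R by ring. lra.
Qed.

Lemma conv_shift (u : nat -> C) (s : C) :
  conv (fun k => u (S k)) s -> conv u (u O + s).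
Proof.
  intros H. apply is_lim_seq_incr_1.
  eapply is_lim_seq_ext; [|exact H]. intros n. cbv beta.
  rewrite csum_S_l. f_equal. ring.
Qed.

(** A radius above 1 places the whole segment [0, 1] in the open disc of convergence, where termwise
    differentiation holds. *)
Lemma CV_radius_ge_2 (a : nat -> R) (K : R) :
  (forall j, (Rabs (a j) <= K * ((/2) ^ j * (/2) ^ j))%R) -> Rbar_le 2 (CV_radius a).
Proof.
  intros H. apply CV_radius_bounded. exists K. intros j.
  rewrite Rabs_mult, <- RPow_abs, (Rabs_pos_eq 2) by lra.
  assert (HK' : (0 <= K)%R).
  { specialize (H O). simpl in H. assert (Q := Rabs_pos (a O)). lra. }
  specialize (H j). assert (P := half_pow_pos j).
  assert (P2 : (0 < 2 ^ j)%R) by (apply pow_lt; lra).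
  assert (E : ((/2) ^ j * 2 ^ j = 1)%R).
  { rewrite <- Rpow_mult_distr. replace (/2 * 2)%R with 1%R by field. apply pow1. }
  apply Rle_trans with (K * ((/2) ^ j * (/2) ^ j) * 2 ^ j)%R.
  - apply Rmult_le_compat_r; lra.
  - replace (K * ((/2) ^ j * (/2) ^ j) * 2 ^ j)%R
      with (K * (/2) ^ j * ((/2) ^ j * 2 ^ j))%R by ring.
    rewrite E. assert (P1 : ((/2) ^ j <= 1)%R).
    { rewrite <- (pow1 j). apply pow_incr. lra. }
    apply Rmult_le_compat_l with (r := K) in P1; lra.
Qed.

Lemma conv_pseries_derive (a : nat -> C) (K : R) :
  (forall j, (Cmod (a j) <= K * ((/2) ^ j * (/2) ^ j))%R) ->
  exists F D : R -> C, forall t : R, (0 <= t <= 1)%R ->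
    conv (fun j => a j * t ^ j) (F t) /\
    conv (fun j => S j * a (S j) * t ^ j) (D t) /\
    cderive F t (D t).
Proof.
  intros H.
  set (x := fun j => Re (a j)). set (y := fun j => Im (a j)).
  assert (Rx : Rbar_le 2 (CV_radius x)).
  { apply (CV_radius_ge_2 _ K). intros j. eapply Rle_trans; [apply re_le_Cmod|apply H]. }
  assert (Ry : Rbar_le 2 (CV_radius y)).
  { apply (CV_radius_ge_2 _ K). intros j. eapply Rle_trans; [apply im_le_Cmod|apply H]. }
  exists (fun t => (PSeries x t, PSeries y t)).
  exists (fun t => (PSeries (PS_derive x) t, PSeries (PS_derive y) t)).
  intros t Ht.
  assert (Tx : Rbar_lt (Rabs t) (CV_radius x)).
  { apply Rbar_lt_le_trans with (2 := Rx). simpl. rewrite Rabs_pos_eq; lra. }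
  assert (Ty : Rbar_lt (Rabs t) (CV_radius y)).
  { apply Rbar_lt_le_trans with (2 := Ry). simpl. rewrite Rabs_pos_eq; lra. }
  split; [|split].
  - apply conv_of_parts.
    + apply is_series_ext with (fun n => x n * t ^ n)%R.
      { intros n. rewrite <- RtoC_pow, re_scal_r. reflexivity. }
      apply is_pseries_R, PSeries_correct, CV_radius_inside, Tx.
    + apply is_series_ext with (fun n => y n * t ^ n)%R.
      { intros n. rewrite <- RtoC_pow, im_scal_r. reflexivity. }
      apply is_pseries_R, PSeries_correct, CV_radius_inside, Ty.
  - apply conv_of_parts.
    + apply is_series_ext with (fun n => PS_derive x n * t ^ n)%R.
      { intros n. rewrite <- RtoC_pow, re_scal_r, re_scal_l. reflexivity. }
      apply is_pseries_R, PSeries_correct, CV_radius_inside.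
      now rewrite CV_radius_derive.
    + apply is_series_ext with (fun n => PS_derive y n * t ^ n)%R.
      { intros n. rewrite <- RtoC_pow, im_scal_r, im_scal_l. reflexivity. }
      apply is_pseries_R, PSeries_correct, CV_radius_inside.
      now rewrite CV_radius_derive.
  - split; simpl; apply (is_derive_PSeries _ _); assumption.
Qed.

Lemma Clog_right (z : C) : (0 < Re z)%R ->
  Clog z = (ln (Cmod z), atan (Im z / Re z)).
Proof.
  destruct z as [x y]. simpl. intros H. unfold Clog. simpl.
  destruct (Rlt_dec 0 x); [reflexivity|lra].
Qed.

Lemma Clog_1 : Clog 1 = 0.
Proof.
  rewrite Clog_right by (simpl; lra). rewrite Cmod_1, ln_1. simpl.
  replace (0 / 1)%R with 0%R by field. now rewrite atan_0.
Qed.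

(** Origin of the constant 1/8: against the growth 2^j of the coefficients it leaves 4^(-j), the
    decay that [conv_pseries_derive] expects. *)
Lemma Cmod_rbin_pow (w v : C) (W j : nat) : (Cmod w <= W)%R -> (Cmod v <= / 8)%R ->
  (Cmod (rbin w j * v ^ j) <= 2 ^ W * ((/2) ^ j * (/2) ^ j))%R.
Proof.
  intros Hw Hv. rewrite Cmod_mult, Cmod_pow.
  replace (2 ^ W * ((/2) ^ j * (/2) ^ j))%R with (2 ^ (W + j) * (/8) ^ j)%R.
  - apply Rmult_le_compat; try apply Cmod_ge_0.
    + apply pow_le, Cmod_ge_0.
    + now apply Cmod_rbin.
    + apply pow_incr. split; [apply Cmod_ge_0|assumption].
  - rewrite pow_add, Rmult_assoc, <- !Rpow_mult_distr. do 2 f_equal. field.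
Qed.

(* Both sides, as functions of [t] along the segment from 0 to [v], solve
   [(1 - t v) F' = w v F]. *)
Lemma binomial_series (w v : C) : (Cmod v <= / 8)%R ->
  conv (fun j => rbin w j * v ^ j) (Cexp (- w * Clog (1 - v))).
Proof.
  intros Hv.
  set (a := fun j => rbin w j * v ^ j).
  destruct (conv_pseries_derive a (2 ^ nat_above (Cmod w))) as (F & D & H).
  { intros j. apply Cmod_rbin_pow; [apply nat_above_le|assumption]. }
  set (lg := fun s : R => (ln (Cmod (1 - s * v)), atan (Im (1 - s * v) / Re (1 - s * v)))
             : C).
  assert (Rv : (Rabs (Re v) <= / 8)%R).
  { eapply Rle_trans; [apply re_le_Cmod|assumption]. }
  apply Rabs_le_between in Rv.
  assert (Hlg : forall s : R, (0 <= s <= 1)%R -> lg s = Clog (1 - s * v)).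
  { intros s Hs. unfold lg. rewrite Clog_right; [reflexivity|].
    destruct v. simpl in *. nra. }
  assert (E : F 0%R * Cexp (w * lg 0%R) = F 1%R * Cexp (w * lg 1%R)).
  { apply (cderive_0_const (fun s => F s * Cexp (w * lg s))).
    intros t Ht. destruct (H t Ht) as (HF & HD & HC).
    assert (P : (0 < 1 - t * Re v)%R) by nra.
    assert (N : 1 - t * v <> 0).
    { intros Q. apply (f_equal Re) in Q. destruct v. simpl in *. lra. }
    assert (HL := cderive_log_segment v t P). fold (lg t) in HL.
    assert (HL2 := cderive_mult _ _ _ _ _ (cderive_const w t) HL).
    assert (HE := cderive_Cexp _ _ _ HL2).
    assert (HM := cderive_mult _ _ _ _ _ HC HE).
    (* The recurrence [rbin_S], summed over j: the terms j a_j t^j add up to t F'(t). *)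
    assert (OD : D t = v * (w * F t + t * D t)).
    { eapply conv_unique; [exact HD|].
      assert (HS : conv (fun j => j * a j * t ^ j) (O * a O * t ^ O + t * D t)).
      { apply (conv_shift (fun j => j * a j * t ^ j)).
        eapply conv_ext; [|apply (conv_scal t _ _ HD)].
        intros k. cbv beta. rewrite Cpow_S. ring. }
      rewrite INRC_0, !Cmult_0_l, Cplus_0_l in HS.
      eapply conv_ext;
        [|apply (conv_scal v _ _ (conv_plus _ _ _ _ (conv_scal w _ _ HF) HS))].
      intros k. cbv beta. unfold a. rewrite Cpow_S.
      replace (S k * (rbin w (S k) * (v * v ^ k)) * t ^ k)
        with (S k * rbin w (S k) * (v * v ^ k) * t ^ k) by ring.
      rewrite rbin_S. ring. }
    match type of HM with cderive _ _ ?d => replace (RtoC 0) with d; [exact HM|] end.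
    change ((fun s : R => (ln (Cmod (1 - s * v)),
       atan (Im (1 - s * v) / Re (1 - s * v))) : C) t) with (lg t).
    assert (OD' : D t * (1 - t * v) = v * w * F t).
    { replace (D t * (1 - t * v)) with (D t - t * v * D t) by ring.
      rewrite OD at 1. ring. }
    replace (D t) with (v * w * F t / (1 - t * v)) by (rewrite <- OD'; now field).
    now field. }
  destruct (H 0%R ltac:(lra)) as (H0 & _). destruct (H 1%R ltac:(lra)) as (H1 & _).
  assert (F0 : F 0%R = 1).
  { eapply conv_unique; [exact H0|].
    apply is_lim_seq_incr_1, is_lim_seq_ext with (fun _ => 0%R); [|apply is_lim_seq_const].
    intros n. rewrite csum_S_l, (csum_ext _ (fun _ => 0)), csum_0.
    - unfold a. simpl. rewrite rbin_0.
      replace (1 * 1 * 1 + 0 - 1) with (RtoC 0) by ring. now rewrite Cmod_0.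
    - intros k _. rewrite (Cpow_S (RtoC 0)). ring. }
  rewrite !Hlg in E by lra. rewrite F0 in E.
  replace (1 - 0%R * v) with (RtoC 1) in E by ring.
  rewrite Clog_1, Cmult_0_r, Cexp_0 in E.
  replace (1 - 1%R * v) with (1 - v) in E by ring.
  replace (- w * Clog (1 - v)) with (- (w * Clog (1 - v))) by ring.
  rewrite Cexp_opp.
  assert (N := Cexp_neq_0 (w * Clog (1 - v))).
  replace (/ Cexp (w * Clog (1 - v))) with (F 1%R).
  - eapply conv_ext; [|exact H1]. intros k. cbv beta. rewrite Cpow_1_l. ring.
  - replace (F 1%R) with (F 1%R * Cexp (w * Clog (1 - v)) / Cexp (w * Clog (1 - v)))
      by now field.
    rewrite <- E. now field.
Qed.

(** * Logarithms and powers near 1 *)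

Lemma Cmod_Cexp (z : C) : Cmod (Cexp z) = exp (Re z).
Proof.
  unfold Cexp. rewrite Cmod_mult, Cmod_R, Rabs_pos_eq by (apply Rlt_le, exp_pos).
  replace (Cmod (cos (Im z), sin (Im z))) with 1%R; [ring|].
  unfold Cmod. simpl fst. simpl snd.
  replace (cos (Im z) ^ 2 + sin (Im z) ^ 2)%R with 1%R.
  - now rewrite sqrt_1.
  - rewrite <- (sin2_cos2 (Im z)). unfold Rsqr. ring.
Qed.

Lemma Cexp_Clog (z : C) : (0 < Re z)%R -> Cexp (Clog z) = z.
Proof.
  intros H. rewrite Clog_right by assumption. destruct z as [x y].
  unfold Cexp. simpl in *.
  assert (P : (0 < Cmod (x, y))%R).
  { apply Cmod_gt_0. intros Q. apply (f_equal Re) in Q. simpl in Q. lra. }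
  rewrite exp_ln, cos_atan, sin_atan by assumption.
  assert (E : Cmod (x, y) = (x * sqrt (1 + (y / x)²))%R).
  { unfold Cmod. simpl fst. simpl snd.
    replace (x ^ 2 + y ^ 2)%R with (x ^ 2 * (1 + (y / x)²))%R
      by (unfold Rsqr; field; lra).
    rewrite sqrt_mult_alt by apply pow2_ge_0. now rewrite sqrt_pow2 by lra. }
  assert (S : (0 < sqrt (1 + (y / x)²))%R).
  { apply sqrt_lt_R0. assert (Q := Rle_0_sqr (y / x)). lra. }
  rewrite E. apply injective_projections; simpl; field; lra.
Qed.

Lemma Clog_Cexp (z : C) : (Rabs (Im z) < PI / 2)%R -> Clog (Cexp z) = z.
Proof.
  intros H. apply Rabs_lt_between in H.
  assert (HC : (0 < cos (Im z))%R) by (apply cos_gt_0; lra).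
  assert (HE := exp_pos (Re z)).
  assert (HR : (0 < Re (Cexp z))%R).
  { unfold Cexp. simpl. nra. }
  rewrite Clog_right by assumption. rewrite Cmod_Cexp, ln_exp.
  replace (Im (Cexp z) / Re (Cexp z))%R with (tan (Im z)).
  - rewrite atan_tan by lra. now destruct z.
  - unfold Cexp, tan. simpl. field.
    repeat split; try lra; apply Rgt_not_eq; nra.
Qed.

Lemma atan_le_self (x : R) : (0 <= x)%R -> (atan x <= x)%R.
Proof.
  intros H. destruct (Req_dec x 0) as [->|N]; [rewrite atan_0; lra|].
  destruct (MVT_gen atan 0 x (fun y => / (1 + y²))%R) as (y & Hy & E).
  - intros z _. apply is_derive_atan.
  - intros z _. apply derivable_continuous_pt, derivable_pt_atan.
  - rewrite atan_0, !Rminus_0_r in E. rewrite E.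
    assert (Q := Rle_0_sqr y).
    assert (/ (1 + y²) <= 1)%R.
    { rewrite <- Rinv_1. apply Rinv_le_contravar; lra. }
    nra.
Qed.

Lemma Rabs_atan_le (x : R) : (Rabs (atan x) <= Rabs x)%R.
Proof.
  destruct (Rle_dec 0 x) as [H|H].
  - assert (P := atan_le_self x H).
    assert (0 <= atan x)%R.
    { destruct H as [H| <-]; [|rewrite atan_0; lra].
      rewrite <- atan_0. left. now apply atan_increasing. }
    rewrite !Rabs_pos_eq; lra.
  - assert (P := atan_le_self (- x) ltac:(lra)). rewrite atan_opp in P.
    assert (atan x < 0)%R by (rewrite <- atan_0; apply atan_increasing; lra).
    rewrite !Rabs_left; lra.
Qed.

Lemma Re_near_1 (u : C) : (Cmod (u - 1) <= / 2)%R -> (/ 2 <= Re u)%R.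
Proof.
  intros H. assert (Q := re_le_Cmod (u - 1)).
  assert (E : Re (u - 1) = (Re u - 1)%R) by (destruct u; reflexivity).
  rewrite E in Q. assert (Q' : (Rabs (Re u - 1) <= / 2)%R) by lra.
  apply Rabs_le_between in Q'. lra.
Qed.

Lemma Im_Clog_near_1 (u : C) : (Cmod (u - 1) <= / 2)%R ->
  (Rabs (Im (Clog u)) <= 2 * Cmod (u - 1))%R.
Proof.
  intros H. assert (R := Re_near_1 u H).
  rewrite Clog_right by lra. simpl.
  eapply Rle_trans; [apply Rabs_atan_le|].
  unfold Rdiv. rewrite Rabs_mult, Rabs_inv, (Rabs_pos_eq (Re u)) by lra.
  assert (Q := im_le_Cmod (u - 1)).
  replace (Im (u - 1)) with (Im u) in Q by (destruct u; simpl; ring).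
  assert (/ Re u <= 2)%R.
  { replace 2%R with (/ / 2)%R by field. apply Rinv_le_contravar; lra. }
  assert (0 < / Re u)%R by (apply Rinv_0_lt_compat; lra).
  assert (P := Rabs_pos (Im u)). nra.
Qed.

(** No branch is crossed: the second hypothesis keeps N times the argument of u within 1, below
    PI/2. This turns powers of 1 - v = u^(-N) into powers of u. *)
Lemma Clog_inv_pow (u : C) (N : nat) :
  (Cmod (u - 1) <= / 2)%R -> (2 * N * Cmod (u - 1) <= 1)%R ->
  Clog (/ u ^ N) = - (N * Clog u).
Proof.
  intros H HN. assert (R := Re_near_1 u H). assert (I := Im_Clog_near_1 u H).
  rewrite <- (Cexp_Clog u) at 1 by lra.
  rewrite <- Cexp_mul_nat, <- Cexp_opp. apply Clog_Cexp.
  replace (Im (- (N * Clog u))) with (- (N * Im (Clog u)))%R.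
  - rewrite Rabs_Ropp, Rabs_mult, (Rabs_pos_eq N) by apply pos_INR.
    assert (P := PI2_1). assert (Q := pos_INR N). nra.
  - destruct (Clog u). simpl. ring.
Qed.

Lemma Cmod_pow_near_1 (u : C) (N : nat) : (Cmod (u - 1) <= 1)%R ->
  (Cmod (u ^ N - 1) <= N * 2 ^ N * Cmod (u - 1))%R.
Proof.
  intros H.
  assert (U : (Cmod u <= 2)%R).
  { replace u with ((u - 1) + 1) by ring. eapply Rle_trans; [apply Cmod_triangle|].
    rewrite Cmod_1. lra. }
  induction N as [|N IH].
  - replace (u ^ 0 - 1) with (RtoC 0) by (simpl; ring). rewrite Cmod_0.
    change (INR 0) with 0%R. lra.
  - rewrite Cpow_S.
    replace (u * u ^ N - 1) with (u ^ N * (u - 1) + (u ^ N - 1)) by ring.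
    eapply Rle_trans; [apply Cmod_triangle|].
    rewrite Cmod_mult, Cmod_pow, S_INR. simpl pow.
    assert (HP : (Cmod u ^ N <= 2 ^ N)%R).
    { apply pow_incr. split; [apply Cmod_ge_0|assumption]. }
    assert (0 <= Cmod (u - 1))%R by apply Cmod_ge_0.
    assert (0 < 2 ^ N)%R by (apply pow_lt; lra).
    assert (0 <= N)%R by apply pos_INR.
    assert (0 <= N * 2 ^ N * Cmod (u - 1))%R by (repeat apply Rmult_le_pos; lra).
    nra.
Qed.

Lemma neq_0_near_1 (u : C) : (Cmod (u - 1) <= / 2)%R -> u <> 0.
Proof. intros H ->. apply Re_near_1 in H. simpl in H. lra. Qed.

Lemma one_minus_inv_pow_small (N : nat) (eps : R) : (0 < eps)%R ->
  exists rho : R, (0 < rho <= / 2)%R /\ forall u : C, (Cmod (u - 1) <= rho)%R ->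
    (Cmod (1 - / u ^ N) <= eps)%R /\ (2 * N * Cmod (u - 1) <= 1)%R.
Proof.
  intros He.
  (* As |u^N - 1| <= N 2^N |u - 1|, the radius m/L gives |u^N - 1| <= m/2, hence |u^N| >= 1/2 and a
     quotient of at most m. Also L >= 2 N yields the second bound. *)
  set (L := (2 * (N + 1) * 2 ^ N)%R).
  assert (PN := pos_INR N).
  assert (P1 : (1 <= 2 ^ N)%R) by (apply pow_R1_Rle; lra).
  assert (PL : (2 <= L)%R) by (unfold L; nra).
  set (m := Rmin 1 eps).
  assert (Hm : (0 < m <= 1 /\ m <= eps)%R).
  { unfold m. split; [split|]; [apply Rmin_pos; lra|apply Rmin_l|apply Rmin_r]. }
  exists (m / L)%R.
  assert (B : (0 < m / L)%R) by (apply Rdiv_lt_0_compat; lra).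
  assert (E : (m / L * L = m)%R) by (field; lra).
  split; [split; [assumption|nra]|].
  intros u Hu. assert (Q := Cmod_ge_0 (u - 1)).
  assert (H2 : (Cmod (u - 1) <= / 2)%R) by nra.
  assert (T := Cmod_pow_near_1 u N ltac:(lra)).
  assert (X : (L * Cmod (u - 1) <= m)%R) by nra.
  assert (Y : (0 <= N * 2 ^ N * Cmod (u - 1))%R) by (repeat apply Rmult_le_pos; lra).
  assert (Z : (N * 2 ^ N * Cmod (u - 1) <= m / 2)%R) by (unfold L in X; nra).
  assert (NZ := neq_0_near_1 u H2).
  assert (NZ' : u ^ N <> 0) by now apply Cpow_nz.
  split.
  - replace (1 - / u ^ N) with ((u ^ N - 1) / u ^ N) by now field.
    rewrite Cmod_div by assumption.
    assert (LB : (/ 2 <= Cmod (u ^ N))%R).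
    { assert (K := Cmod_triangle (u ^ N) (- (u ^ N - 1))).
      replace (u ^ N + - (u ^ N - 1)) with (RtoC 1) in K by ring.
      rewrite Cmod_1, Cmod_opp in K. lra. }
    apply Rmult_le_reg_r with (Cmod (u ^ N)); [lra|].
    unfold Rdiv. rewrite Rmult_assoc, Rinv_l by lra. nra.
  - unfold L in X. assert (0 <= N * Cmod (u - 1))%R by (apply Rmult_le_pos; lra). nra.
Qed.

(** * The expansion of u^(-Na) G_l(-a, -beta, -c; u^N) in powers of s *)

(* The Lagrange-inversion coefficients of both parts: [beta = p/q] in (i) and
   [beta = -p/n] in (ii); [/ poch (a - l) l] is the paper's [(a)_{-l}]. *)
Definition coef (l : nat) (a c beta : C) (m : nat) : C :=
  (- (1)) ^ m * (poch (a - l + beta * m) (l + m) / poch (a - l) l)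
  * ((a + c - l) / (a + c - l + beta * m)) / poch 1 m.

Lemma finite_bound (f : nat -> R) (n : nat) :
  exists M : R, (0 <= M)%R /\ forall m, (m < n)%nat -> (f m <= M)%R.
Proof.
  induction n as [|n (M & HM & H)].
  - exists 0%R. split; [lra|]. intros m Hm. lia.
  - exists (Rmax M (f n)). split.
    + eapply Rle_trans; [exact HM|apply Rmax_l].
    + intros m Hm. destruct (Nat.eq_dec m n) as [->|N]; [apply Rmax_r|].
      eapply Rle_trans; [apply H; lia|apply Rmax_l].
Qed.

(** Once m exceeds 2|E|/|beta|, the denominator has modulus at least |E|, so the quotient is at most
    1; finitely many m remain. *)
Lemma ratio_bound (E beta : C) : beta <> 0 ->
  (forall m : nat, E + beta * m <> 0) ->
  exists M : R, (0 <= M)%R /\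
    forall m : nat, (Cmod (E / (E + beta * m)) <= M)%R.
Proof.
  intros Hb H.
  assert (Pb : (0 < Cmod beta)%R) by now apply Cmod_gt_0.
  set (n := nat_above (2 * Cmod E / Cmod beta)).
  destruct (finite_bound (fun m => Cmod (E / (E + beta * m))) n) as (M & HM & HF).
  exists (Rmax M 1). split.
  - eapply Rle_trans; [exact HM|apply Rmax_l].
  - intros m. destruct (Nat.lt_ge_cases m n) as [L|L].
    + eapply Rle_trans; [now apply HF|apply Rmax_l].
    + eapply Rle_trans; [|apply Rmax_r].
      assert (P := proj1 (Cmod_gt_0 _) (H m)).
      rewrite Cmod_div by apply H. apply Rmult_le_reg_r with (1 := P).
      unfold Rdiv. rewrite Rmult_assoc, Rinv_l, Rmult_1_l, Rmult_1_r by lra.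
      assert (T := Cmod_triangle (E + beta * m) (- E)).
      replace (E + beta * m + - E) with (beta * m) in T by ring.
      rewrite Cmod_opp, Cmod_mult, Cmod_R, Rabs_pos_eq in T by apply pos_INR.
      apply le_INR in L.
      assert (U := nat_above_le (2 * Cmod E / Cmod beta)). fold n in U.
      assert (V : (2 * Cmod E <= Cmod beta * m)%R).
      { replace (2 * Cmod E)%R with (Cmod beta * (2 * Cmod E / Cmod beta))%R
          by (field; lra).
        apply Rmult_le_compat_l; lra. }
      lra.
Qed.

Lemma Cmod_fact_ratio (l m : nat) : l = 0%nat \/ l = 1%nat ->
  (Cmod (poch 1 (l + m) / poch 1 m) <= 2 ^ m)%R.
Proof.
  assert (F := fact_poch_neq_0 m). intros [-> | ->].
  - simpl Nat.add. replace (poch 1 m / poch 1 m) with (RtoC 1) by now field.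
    rewrite Cmod_1. apply pow_R1_Rle. lra.
  - change (1 + m)%nat with (S m). rewrite poch_one_S.
    replace (S m * poch 1 m / poch 1 m) with (RtoC (S m)) by now field.
    rewrite Cmod_R, Rabs_pos_eq by apply pos_INR. rewrite S_INR.
    clear F. induction m as [|m IH]; simpl; [change (INR 0) with 0%R; lra|].
    rewrite S_INR. assert (P := pos_INR m). lra.
Qed.

Lemma Cmod_affine (z beta : C) (m : nat) :
  (Cmod (z + beta * m) <= (nat_above (Cmod z) + nat_above (Cmod beta) * m)%nat)%R.
Proof.
  eapply Rle_trans; [apply Cmod_triangle|].
  rewrite Cmod_mult, Cmod_R, (Rabs_pos_eq m) by apply pos_INR.
  rewrite plus_INR, mult_INR.
  assert (H1 := nat_above_le (Cmod z)). assert (H2 := nat_above_le (Cmod beta)).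
  assert (P := pos_INR m). nra.
Qed.

Lemma Cmod_m1_pow (m : nat) : Cmod ((- (1)) ^ m) = 1%R.
Proof. rewrite Cmod_pow, Cmod_m1. apply pow1. Qed.

Lemma coef_bound (l : nat) (a c beta : C) : l = 0%nat \/ l = 1%nat -> beta <> 0 ->
  poch (a - l) l <> 0 -> (forall m : nat, a + c - l + beta * m <> 0) ->
  exists K B : R, (0 <= K)%R /\ (1 <= B)%R /\
    forall m, (Cmod (coef l a c beta m) <= K * B ^ m)%R.
Proof.
  intros Hl Hb Ha HE.
  destruct (ratio_bound (a + c - l) beta Hb HE) as (M & HM & HR).
  set (X := nat_above (Cmod (a - l))). set (Y := nat_above (Cmod beta)).
  assert (PA : (0 < / Cmod (poch (a - l) l))%R)
    by now apply Rinv_0_lt_compat, Cmod_gt_0.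
  (* In the exponent, [Y] comes from the parameter growing like beta m, one unit from the length l +
     m of the symbol, and one from [Cmod_fact_ratio]. *)
  exists (2 ^ (X + l) * / Cmod (poch (a - l) l) * M)%R, (2 ^ (Y + 2))%R.
  split; [|split].
  - repeat apply Rmult_le_pos; try lra. apply pow_le; lra.
  - apply pow_R1_Rle. lra.
  - intros m.
    assert (F := fact_poch_neq_0 m). assert (F' := fact_poch_neq_0 (l + m)).
    replace (coef l a c beta m) with
      ((- (1)) ^ m * (rbin (a - l + beta * m) (l + m) * / poch (a - l) l)
       * (poch 1 (l + m) / poch 1 m) * ((a + c - l) / (a + c - l + beta * m))).
    2:{ unfold coef, rbin. field. auto. }
    rewrite !Cmod_mult, Cmod_m1_pow, Rmult_1_l, (Cmod_inv (poch (a - l) l)) by assumption.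
    assert (B1 := Cmod_rbin _ _ (l + m) (Cmod_affine (a - l) beta m)).
    fold X Y in B1.
    assert (B2 := Cmod_fact_ratio l m Hl).
    assert (B3 := HR m).
    replace (2 ^ (X + l) * / Cmod (poch (a - l) l) * M * (2 ^ (Y + 2)) ^ m)%R
      with (2 ^ (X + Y * m + (l + m)) * / Cmod (poch (a - l) l) * 2 ^ m * M)%R.
    + repeat (apply Rmult_le_compat; try apply Cmod_ge_0; auto);
        repeat apply Rmult_le_pos; try apply Cmod_ge_0; lra.
    + rewrite <- pow_mult. replace ((Y + 2) * m)%nat with (Y * m + m + m)%nat by ring.
      rewrite !pow_add. ring.
Qed.

(** The symbols of [coef] and of the binomial series concatenate: with x = a - l + beta m, (x)_(l+m)
    (x+l+m)_(N-m) = (x)_(l+N). This turns a diagonal into a finite difference. *)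
Lemma csum_row_diag (l : nat) (a c beta v : C) (N : nat) :
  csum (fun m => coef l a c beta m * v ^ m
     * (rbin (a + m + beta * m) (N - m) * v ^ (N - m))) (S N)
  = altsum N (fun m => poch (a - l + beta * m) (l + N)
       * ((a + c - l) / (a + c - l + beta * m))) / poch (a - l) l * v ^ N.
Proof.
  unfold altsum.
  replace (csum (fun m => (- (1)) ^ m / (poch 1 m * poch 1 (N - m)) * (poch (a - l + beta * m) (l + N)
       * ((a + c - l) / (a + c - l + beta * m)))) (S N) / poch (a - l) l * v ^ N)
   with (/ poch (a - l) l * v ^ N * csum (fun m => (- (1)) ^ m / (poch 1 m * poch 1 (N - m)) * (poch (a - l + beta * m) (l + N)
       * ((a + c - l) / (a + c - l + beta * m)))) (S N))
   by (unfold Cdiv; ring).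
  rewrite <- csum_scal. apply csum_ext. intros m Hm.
  replace (l + N)%nat with ((l + m) + (N - m))%nat by lia.
  replace (v ^ N) with (v ^ m * v ^ (N - m)) by (rewrite <- Cpow_add_r; f_equal; lia).
  rewrite poch_add. unfold coef, rbin.
  replace (a - l + beta * m + (l + m)%nat) with (a + m + beta * m)
    by (rewrite INRC_add; ring).
  assert (F1 := fact_poch_neq_0 m). assert (F2 := fact_poch_neq_0 (N - m)).
  assert (EI : / (poch 1 m * poch 1 (N - m)) = / poch 1 m * / poch 1 (N - m))
    by (field; auto).
  unfold Cdiv. rewrite EI. ring.
Qed.

Lemma expansion_in_v (l : nat) (a c beta : C) : l = 0%nat \/ l = 1%nat -> beta <> 0 ->
  poch (a - l) l <> 0 -> (forall m : nat, a + c - l + beta * m <> 0) ->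
  exists eps : R, (0 < eps)%R /\ forall v : C, (Cmod v <= eps)%R ->
  exists s : C,
    conv (fun N => altsum N (fun m => poch (a - l + beta * m) (l + N)
            * ((a + c - l) / (a + c - l + beta * m))) / poch (a - l) l * v ^ N) s /\
    conv (fun m => coef l a c beta m * v ^ m
            * Cexp (- (a + m + beta * m) * Clog (1 - v))) s.
Proof.
  intros Hl Hb Ha HE.
  destruct (coef_bound l a c beta Hl Hb Ha HE) as (K & B & HK & HB & HC).
  set (X := nat_above (Cmod a)). set (Y := nat_above (Cmod (1 + beta))).
  (* [B] measures the growth of [coef], [2 ^ Y] that of the binomial coefficients through their
     shift (1 + beta) m. With |v| <= 1/(8R) the terms are O((R|v|)^m (2|v|)^j), thus O(4^(-m)
     2^(-j)), including the surplus factor of [conv_diagonals]. *)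
  set (R := (B * 2 ^ Y)%R).
  assert (P2 : forall k, (1 <= 2 ^ k)%R) by (intros k; apply pow_R1_Rle; lra).
  assert (HR : (1 <= R)%R) by (unfold R; specialize (P2 Y); nra).
  exists (/ (8 * R))%R. split; [apply Rinv_0_lt_compat; lra|].
  intros v Hv.
  assert (Pv := Cmod_ge_0 v).
  assert (HRv : (R * Cmod v <= / 8)%R).
  { apply Rmult_le_compat_l with (r := R) in Hv; [|lra].
    replace (R * / (8 * R))%R with (/ 8)%R in Hv by (field; lra). assumption. }
  assert (Hv8 : (Cmod v <= / 8)%R) by nra.
  set (t := fun m j => coef l a c beta m * v ^ m
              * (rbin (a + m + beta * m) j * v ^ j)).
  assert (HT : forall m j,
     (Cmod (t m j) <= (K * 2 ^ X) * ((/2) ^ m * (/2) ^ j) * (/2) ^ m)%R).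
  { intros m j. unfold t. rewrite !Cmod_mult, !Cmod_pow.
    assert (B1 := Cmod_rbin _ _ j (Cmod_affine a (1 + beta) m)).
    fold X Y in B1. replace (a + (1 + beta) * m) with (a + m + beta * m) in B1 by ring.
    specialize (HC m).
    apply Rle_trans with
      ((K * B ^ m * Cmod v ^ m) * (2 ^ (X + Y * m + j) * Cmod v ^ j))%R.
    - repeat (apply Rmult_le_compat; try apply Cmod_ge_0; auto);
        repeat apply Rmult_le_pos; try apply Cmod_ge_0;
        try (apply pow_le; apply Cmod_ge_0); try lra.
    - replace (K * B ^ m * Cmod v ^ m * (2 ^ (X + Y * m + j) * Cmod v ^ j))%R
        with (K * 2 ^ X * ((R * Cmod v) ^ m * (2 * Cmod v) ^ j))%R.
      2:{ unfold R. rewrite !pow_add, pow_mult, !Rpow_mult_distr. ring. }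
      rewrite !Rmult_assoc. do 2 (apply Rmult_le_compat_l; [try apply pow_le; lra|]).
      rewrite (Rmult_comm ((/2) ^ j)), <- Rmult_assoc, <- Rpow_mult_distr.
      apply Rmult_le_compat; try (apply pow_le; nra); apply pow_incr; nra. }
  destruct (conv_diagonals t _ HT) as (s & Hs).
  exists s. split.
  - eapply conv_ext; [|exact Hs]. intros N. apply csum_row_diag.
  - apply (conv_rows_diagonals t _ _ s HT); [|exact Hs].
    intros m. apply conv_scal, binomial_series, Hv8.
Qed.

(** * Evaluation of G_l by its power series in v *)

Lemma lower_ok_add (L : list C) (b : C) (i : nat) :
  lower_ok L -> In b L -> b + i <> 0.
Proof.
  intros H Hb Q. apply (H b Hb). exists i.
  replace b with (b + i - i) by ring. rewrite Q. ring.
Qed.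

Lemma hyp_conv (upper lower : list C) (z s : C) :
  conv (fun k => Cprod (map (fun b => poch b k) upper)
      / (Cprod (map (fun b => poch b k) lower) * poch 1 k) * z ^ k) s ->
  hyp upper lower z = s.
Proof. apply conv_CSeries. Qed.

(** A parameter pair x + 1 over x contributes only a linear factor. Such pairs occur in G_1, and
    inverted as the last parameters of the large series. *)
Lemma poch_succ_ratio (x : C) (k : nat) : (forall i : nat, x + i <> 0) ->
  poch (x + 1) k / poch x k = (x + k) / x.
Proof.
  intros H.
  assert (Hx : x <> 0) by (specialize (H O); now rewrite INRC_0, Cplus_0_r in H).
  assert (HP : poch x k <> 0) by (apply poch_neq_0; auto).
  replace (poch (x + 1) k) with (poch x k * (x + k) / x); [now field|].
  change (poch x k * (x + k)) with (poch x (S k)). rewrite poch_S_l. now field.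
Qed.

(** The lower parameter of G_l is (a + c - l)/beta + 1; its distance from the non-positive integers
    covers m >= 1, and m = 0 is the remaining hypothesis. *)
Lemma G_lower_neq_0 (l : nat) (a c beta : C) : l = 0%nat \/ l = 1%nat -> beta <> 0 ->
  lower_ok (G_lower l (- a) (- beta) (- c)) -> a + c - l <> 0 ->
  forall m : nat, a + c - l + beta * m <> 0.
Proof.
  intros Hl Hb H HE [|m].
  - now rewrite INRC_0, Cmult_0_r, Cplus_0_r.
  - assert (Q : (a + c - l) / beta + 1 + m <> 0).
    { apply (lower_ok_add _ _ m H). destruct Hl as [-> | ->]; left;
        rewrite ?INRC_S, INRC_0; field; auto. }
    intros Z. apply Q.
    replace ((a + c - l) / beta + 1 + m) with ((a + c - l + beta * S m) / beta)
      by (rewrite INRC_S; now field).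
    rewrite Z. now field.
Qed.

(** For l = 0 this is [altsum_gauss] coefficient by coefficient. For l = 1 the hypergeometric factor
    of G_1 is identified with (1 + beta v) s, and the rational prefactor y/((1 + beta) y - beta) is
    1/(1 + beta v). *)
Lemma G_value (l : nat) (a c beta y s : C) : l = 0%nat \/ l = 1%nat ->
  beta <> 0 -> 1 + beta <> 0 ->
  poch (a - l) l <> 0 -> (forall m : nat, a + c - l + beta * m <> 0) ->
  lower_ok (G_lower l (- a) (- beta) (- c)) ->
  y <> 0 -> y + beta * (y - 1) <> 0 ->
  conv (fun N => altsum N (fun m => poch (a - l + beta * m) (l + N)
          * ((a + c - l) / (a + c - l + beta * m))) / poch (a - l) l
          * ((y - 1) / y) ^ N) s ->
  G l (- a) (- beta) (- c) y = s.
Proof.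
  intros Hl Hb Hb1 Ha HE HL Hy Hy1 Hs.
  set (v := (y - 1) / y) in *.
  set (x := a - l) in *. set (E := a + c - l) in *.
  set (b := E / beta + 1).
  assert (Eb : (- a + - c + l) / - beta + 1 = b).
  { unfold b, E. field. auto. }
  assert (Hb' : forall i : nat, b + i <> 0).
  { intros i. rewrite <- Eb. apply (lower_ok_add _ _ i HL).
    destruct Hl as [-> | ->]; left; rewrite ?INRC_S, INRC_0; field; auto. }
  assert (Hpb : forall k, poch b k <> 0) by (intros k; apply poch_neq_0; auto).
  assert (HG : forall N, altsum N (fun m => poch (x + beta * m) N
       * (E / (E + beta * m))) = poch (- c) N / poch b N).
  { intros N. assert (EE : E = x + c) by (unfold x, E; ring).
    unfold b. rewrite EE. apply altsum_gauss; [assumption|].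
    intros m _. rewrite <- EE. apply HE. }
  destruct Hl as [-> | ->].
  - change (hyp [- c; RtoC 1] (G_lower 0 (- a) (- beta) (- c)) v = s).
    apply hyp_conv. eapply conv_ext; [|exact Hs].
    intros k. cbv beta. change (0 + k)%nat with k. rewrite HG. simpl.
    assert (F := fact_poch_neq_0 k).
    replace ((- a + - c) / - beta + 1) with b
      by (rewrite <- Eb, INRC_0; field; auto).
    field. auto.
  - set (gam := fun N => altsum N (fun m => poch (x + beta * m) (1 + N)
          * (E / (E + beta * m))) / poch x 1) in *.
    change (conv (fun N => gam N * v ^ N) s) in Hs.
    assert (Px : poch x 1 = x) by (simpl; rewrite INRC_0; ring).
    rewrite Px in Ha.
    assert (G0 : gam 0%nat = 1).
    { unfold gam, altsum. rewrite Px. simpl. rewrite INRC_0.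
      specialize (HE O). rewrite INRC_0, Cmult_0_r, Cplus_0_r in HE.
      rewrite Cmult_0_r, !Cplus_0_r. field. auto. }
    (* With X = x/(1 + beta) the first factor is (X + S N)/X, the contribution of the parameter pair
       X + 1 over X. *)
    assert (GS : forall N, gam (S N) + beta * gam N
       = (x + S N + S N * beta) / x * (poch (- c) (S N) / poch b (S N))).
    { intros N. rewrite <- HG.
      assert (T := altsum_gauss_step x E beta N (fun m _ => HE m)).
      unfold gam. rewrite Px.
      match goal with |- ?A / x + beta * (?B / x) = ?Z / x * ?W =>
        replace (A / x + beta * (B / x)) with ((A + beta * B) / x) by (now field);
        replace (Z / x * W) with (Z * W / x) by now field end.
      f_equal. exact T. }
    assert (Hx : forall i : nat, x / (1 + beta) + i <> 0).
    { intros i. apply (lower_ok_add _ _ i HL). right. left. unfold x.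
      rewrite INRC_S, INRC_0. field. split; [assumption|].
      intros Q. apply Hb1. replace (1 + beta) with (- (- beta - 1)) by ring.
      rewrite Q. ring. }
    assert (HH : hyp [- c; x / (1 + beta) + 1; RtoC 1] [b; x / (1 + beta)] v
        = s + (0 + beta * v * s)).
    { apply hyp_conv.
      set (w := fun k => match k with O => RtoC 0 | S N => beta * v * (gam N * v ^ N) end).
      assert (Hw : conv w (0 + beta * v * s)) by (apply (conv_shift w), conv_scal, Hs).
      eapply conv_ext; [|apply (conv_plus _ _ _ _ Hs Hw)].
      intros k. cbv beta.
      assert (F := fact_poch_neq_0 k).
      assert (HP : poch (x / (1 + beta)) k <> 0) by (apply poch_neq_0; auto).
      replace (Cprod (map (fun b0 => poch b0 k) [- c; x / (1 + beta) + 1; RtoC 1]) /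
        (Cprod (map (fun b0 => poch b0 k) [b; x / (1 + beta)]) * poch 1 k) * v ^ k)
        with (poch (- c) k / poch b k
              * (poch (x / (1 + beta) + 1) k / poch (x / (1 + beta)) k) * v ^ k)
        by (simpl; field; auto).
      rewrite poch_succ_ratio by assumption.
      destruct k as [|N].
      - rewrite G0. simpl. rewrite INRC_0. field. auto.
      - unfold w. rewrite Cpow_S.
        replace (gam (S N) * (v * v ^ N) + beta * v * (gam N * v ^ N))
          with ((gam (S N) + beta * gam N) * (v * v ^ N)) by ring.
        rewrite GS. field. auto. }
    change (y / ((1 - - beta) * y + - beta)
      * hyp [- c; (- a + 1) / (- beta - 1) + 1; RtoC 1]
          [(- a + - c + 1) / - beta + 1; (- a + 1) / (- beta - 1)] v = s).
    assert (Hb2 : - beta - 1 <> 0).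
    { intros Q. apply Hb1. replace (1 + beta) with (- (- beta - 1)) by ring.
      rewrite Q. ring. }
    replace ((- a + 1) / (- beta - 1)) with (x / (1 + beta))
      by (unfold x; rewrite INRC_S, INRC_0; field; auto).
    replace ((- a + - c + 1) / - beta + 1) with b
      by (rewrite <- Eb, INRC_S, INRC_0; field; auto).
    rewrite HH. unfold v. field. split; [assumption|].
    intros Q. apply Hy1. rewrite <- Q. ring.
Qed.

(* With [v = 1 - u^(-N)] one has [s = v u^e], where [e = N (1 + beta)]; the
   m-th row of the double series is the m-th term on the left. *)
Lemma G_expansion (l : nat) (a c beta : C) (N e : nat) : l = 0%nat \/ l = 1%nat ->
  beta <> 0 -> (0 < e)%nat -> RtoC e = N * (1 + beta) ->
  poch (a - l) l <> 0 -> a + c - l <> 0 ->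
  lower_ok (G_lower l (- a) (- beta) (- c)) ->
  exists rho : R, (0 < rho <= / 2)%R /\ forall u : C, (Cmod (u - 1) <= rho)%R ->
    conv (fun m => coef l a c beta m * ((1 - / u ^ N) * u ^ e) ^ m)
      (principal_pow u (- (N * a)) * G l (- a) (- beta) (- c) (u ^ N)).
Proof.
  intros Hl Hb He Hbe Ha HE0 HL.
  assert (HE := G_lower_neq_0 l a c beta Hl Hb HL HE0).
  assert (Hb1 : 1 + beta <> 0).
  { intros Q. apply (INRC_neq_0 e He). rewrite Hbe, Q. ring. }
  destruct (expansion_in_v l a c beta Hl Hb Ha HE) as (eps & Heps & HX).
  (* Chosen so that |beta v| <= 1/2, which keeps 1 + beta v, the denominator in the prefactor of
     G_1, away from 0. *)
  set (B := (/ (2 * (1 + Cmod beta)))%R).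
  assert (PB : (0 < B)%R).
  { apply Rinv_0_lt_compat. assert (Q := Cmod_ge_0 beta). lra. }
  destruct (one_minus_inv_pow_small N (Rmin eps B)) as (rho & Hrho & HV).
  { now apply Rmin_pos. }
  exists rho. split; [lra|]. intros u Hu.
  destruct (HV u Hu) as [Hv HN].
  assert (Hu2 : (Cmod (u - 1) <= / 2)%R) by lra.
  assert (Nu := neq_0_near_1 u Hu2).
  assert (NuN : u ^ N <> 0) by now apply Cpow_nz.
  destruct (HX (1 - / u ^ N)) as (s & Hs1 & Hs2).
  { eapply Rle_trans; [exact Hv|apply Rmin_l]. }
  assert (EG : G l (- a) (- beta) (- c) (u ^ N) = s).
  { apply G_value; auto.
    - intros Q.
      assert (Q' : 1 + beta * (1 - / u ^ N) = 0).
      { replace (1 + beta * (1 - / u ^ N)) with ((u ^ N + beta * (u ^ N - 1)) / u ^ N)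
          by now field.
        rewrite Q. now field. }
      assert (T : (Cmod (beta * (1 - / u ^ N)) <= / 2)%R).
      { rewrite Cmod_mult.
        assert (Hv' : (Cmod (1 - / u ^ N) <= B)%R)
          by (eapply Rle_trans; [exact Hv|apply Rmin_r]).
        assert (P := Cmod_ge_0 beta).
        apply Rle_trans with (Cmod beta * B)%R; [now apply Rmult_le_compat_l|].
        unfold B. apply Rmult_le_reg_r with (2 * (1 + Cmod beta))%R; [lra|].
        rewrite Rmult_assoc, Rinv_l; lra. }
      replace (beta * (1 - / u ^ N)) with (-1 + (1 + beta * (1 - / u ^ N))) in T by ring.
      rewrite Q', Cplus_0_r, Cmod_R, Rabs_left in T; lra.
    - replace ((u ^ N - 1) / u ^ N) with (1 - / u ^ N) by now field. exact Hs1. }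
  rewrite EG. unfold principal_pow.
  eapply conv_ext; [|apply (conv_scal (Cexp (- (N * a) * Clog u)) _ _ Hs2)].
  intros m. cbv beta.
  replace (1 - (1 - / u ^ N)) with (/ u ^ N) by ring.
  rewrite Clog_inv_pow by assumption.
  rewrite Cpow_mult_l, <- Cpow_mult_r.
  assert (EU : u ^ (e * m) = Cexp ((e * m)%nat * Clog u)).
  { rewrite Cexp_mul_nat, Cexp_Clog; [reflexivity|].
    assert (R := Re_near_1 u Hu2). lra. }
  rewrite EU, INRC_mul, Hbe.
  replace (Cexp (- (N * a) * Clog u) *
     (coef l a c beta m * (1 - / u ^ N) ^ m *
        Cexp (- (a + m + beta * m) * - (N * Clog u))))
    with (coef l a c beta m * (1 - / u ^ N) ^ m
          * (Cexp (- (N * a) * Clog u) * Cexp (- (a + m + beta * m) * - (N * Clog u))))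
    by ring.
  rewrite <- Cexp_plus.
  (* The contributions of a cancel; the exponent N (1 + beta) m = e m that remains is a natural
     number. *)
  replace (- (N * a) * Clog u + - (a + m + beta * m) * - (N * Clog u))
    with (N * (1 + beta) * m * Clog u) by ring.
  ring.
Qed.

(** * Simple roots near 1 *)

Fixpoint iterate (T : C -> C) (x0 : C) (k : nat) : C :=
  match k with
  | O => x0
  | S j => T (iterate T x0 j)
  end.

(** A first displacement of r/2 and ratio 1/2 keep every iterate in the closed disc; the increments
    form a geometrically dominated series, so [conv_geom] supplies the limit. *)
Lemma contraction_fixed_point (T : C -> C) (x0 : C) (r : R) :
  (forall x y : C, (Cmod (x - x0) <= r)%R -> (Cmod (y - x0) <= r)%R ->
     (Cmod (T x - T y) <= / 2 * Cmod (x - y))%R) ->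
  (Cmod (T x0 - x0) <= r / 2)%R ->
  exists x : C, (Cmod (x - x0) <= r)%R /\ T x = x.
Proof.
  intros HT H0.
  set (x := iterate T x0). set (d := fun k => x (S k) - x k).
  assert (Hr : (0 <= r)%R) by (assert (P := Cmod_ge_0 (T x0 - x0)); lra).
  assert (Ed : forall k, x0 + csum d k = x k).
  { induction k as [|k IH]; simpl csum; [unfold x; simpl; ring|].
    rewrite Cplus_assoc, IH. unfold d. ring. }
  assert (HB : forall k, (Cmod (x k - x0) <= r * (1 - (/2) ^ k))%R /\
                         (Cmod (d k) <= r / 2 * (/2) ^ k)%R).
  { induction k as [|k [IH1 IH2]].
    - split.
      + unfold x. simpl. replace (x0 - x0) with (RtoC 0) by ring. rewrite Cmod_0. lra.
      + simpl. unfold d, x. simpl. lra.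
    - assert (Q : (Cmod (x (S k) - x0) <= r * (1 - (/2) ^ S k))%R).
      { replace (x (S k) - x0) with ((x k - x0) + d k) by (unfold d; ring).
        eapply Rle_trans; [apply Cmod_triangle|]. simpl pow. lra. }
      split; [exact Q|].
      assert (P1 := half_pow_pos k). assert (P2 := half_pow_pos (S k)).
      eapply Rle_trans; [apply (HT (x (S k)) (x k))|].
      + nra.
      + nra.
      + change (x (S k) - x k) with (d k). simpl pow. lra. }
  destruct (conv_geom d (r / 2)) as (s & Hs); [intros k; apply HB|].
  assert (Hs' : (Cmod s <= r)%R).
  { assert (Q := conv_geom_tail d (r / 2) s (fun k => proj2 (HB k)) Hs O).
    simpl in Q. replace (s - 0) with s in Q by ring. lra. }
  exists (x0 + s). assert (E : x0 + s - x0 = s) by ring.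
  split; [now rewrite E|].
  apply Ceq_minus.
  assert (L : is_lim_seq (fun k => Cmod (x k - (x0 + s))) 0).
  { eapply is_lim_seq_ext; [|exact Hs]. intros k. cbv beta. rewrite <- Ed. f_equal. ring. }
  assert (L1 := proj1 (is_lim_seq_incr_1 _ _) L).
  apply Cmod_zero_of_lim with (2 := lim_seq_plus_0 _ _ L L1).
  intros k. cbv beta.
  replace (T (x0 + s) - (x0 + s))
    with (- (T (x k) - T (x0 + s)) + (x (S k) - (x0 + s))) by (unfold x; simpl; ring).
  eapply Rle_trans; [apply Cmod_triangle|]. rewrite Cmod_opp.
  assert (P1 := half_pow_pos k). assert (P2 := proj1 (HB k)).
  assert (Q : (Cmod (T (x k) - T (x0 + s)%C) <= / 2 * Cmod (x k - (x0 + s)))%R).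
  { apply HT; [nra|now rewrite E]. }
  assert (P3 := Cmod_ge_0 (x k - (x0 + s))). lra.
Qed.

(** A uniform form of the derivative of u^n at 1; the error is Lipschitz with a constant
    proportional to r, as a contraction estimate demands. *)
Lemma pow_diff_linear (n : nat) (r : R) (x y : C) : (r <= 1)%R ->
  (Cmod (x - 1) <= r)%R -> (Cmod (y - 1) <= r)%R ->
  (Cmod (x ^ n - y ^ n - n * (x - y)) <= n * 4 ^ n * r * Cmod (x - y))%R.
Proof.
  intros Hr Hx Hy.
  assert (Pr : (0 <= r)%R) by (assert (P := Cmod_ge_0 (x - 1)); lra).
  assert (Px : (Cmod x <= 2)%R).
  { replace x with ((x - 1) + 1) by ring. eapply Rle_trans; [apply Cmod_triangle|].
    rewrite Cmod_1. lra. }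
  assert (PD := Cmod_ge_0 (x - y)).
  induction n as [|n IH].
  - rewrite INRC_0. replace (x ^ 0 - y ^ 0 - 0 * (x - y)) with (RtoC 0) by (simpl; ring).
    rewrite Cmod_0. change (INR 0) with 0%R. lra.
  - rewrite !Cpow_S, INRC_S, S_INR.
    replace (x * x ^ n - y * y ^ n - (n + 1) * (x - y))
      with (x * (x ^ n - y ^ n - n * (x - y))
            + (n * (x - 1) * (x - y) + (y ^ n - 1) * (x - y))) by ring.
    eapply Rle_trans; [apply Cmod_triangle|].
    rewrite Cmod_mult.
    assert (T := Cmod_triangle (n * (x - 1) * (x - y)) ((y ^ n - 1) * (x - y))).
    rewrite !Cmod_mult, Cmod_R, (Rabs_pos_eq n) in T by apply pos_INR.
    assert (Y := Cmod_pow_near_1 y n ltac:(lra)).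
    assert (Pn := pos_INR n).
    assert (P1 : (1 <= 2 ^ n)%R) by (apply pow_R1_Rle; lra).
    assert (P24 : (2 ^ n <= 4 ^ n)%R) by (apply pow_incr; lra).
    set (D := Cmod (x - y)) in *.
    assert (Y' : (Cmod (y ^ n - 1) <= n * 4 ^ n * r)%R).
    { eapply Rle_trans; [exact Y|]. apply Rmult_le_compat; try lra.
      - apply Rmult_le_pos; lra.
      - apply Cmod_ge_0.
      - apply Rmult_le_compat_l; lra. }
    assert (Z1 : (Cmod x * Cmod (x ^ n - y ^ n - n * (x - y))
                  <= 2 * (n * 4 ^ n * r * D))%R)
      by (apply Rmult_le_compat; try apply Cmod_ge_0; assumption).
    assert (Z2 : (n * Cmod (x - 1) * D <= n * 4 ^ n * r * D)%R).
    { apply Rmult_le_compat_r; [assumption|]. rewrite Rmult_assoc.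
      apply Rmult_le_compat_l; [assumption|]. nra. }
    assert (Z3 : (Cmod (y ^ n - 1) * D <= n * 4 ^ n * r * D)%R)
      by (now apply Rmult_le_compat_r).
    assert (Z4 : (0 <= 4 ^ n * r * D)%R) by (repeat apply Rmult_le_pos; lra).
    simpl pow. lra.
Qed.

(** Newton's iteration with the derivative frozen at its limiting value d = n - g0 p, which is n - p
    or n and so at least 1. The two cases are the rescaled equations of (i) at beta = 0 and of (ii)
    at g = 0. *)
Lemma trinomial_root_near_1 (n p : nat) (g0 b0 : C) : (p < n)%nat ->
  (g0 = 1 /\ b0 = 0) \/ (g0 = 0 /\ b0 = 1) ->
  exists r0 : R, (0 < r0)%R /\ forall r : R, (0 < r <= r0)%R ->
  exists delta : R, (0 < delta)%R /\ forall g b : C,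
    (Cmod (g - g0) <= delta)%R -> (Cmod (b - b0) <= delta)%R ->
    exists! u : C, (Cmod (u - 1) < r)%R /\ u ^ n - g * u ^ p - b = 0.
Proof.
  intros Hpn Hgb.
  (* Collects the errors of u^n, of g u^p and of replacing g0 by g. As |g| <= 2, the iteration has
     Lipschitz constant at most 2 L r, and L r <= 1/8. *)
  set (L := (n * 4 ^ n + p * 4 ^ p + p + 1)%R).
  assert (P4 : forall k, (1 <= 4 ^ k)%R) by (intros k; apply pow_R1_Rle; lra).
  assert (Pn := pos_INR n). assert (Pp := pos_INR p).
  assert (A1 : (0 <= n * 4 ^ n)%R) by (specialize (P4 n); nra).
  assert (A2 : (0 <= p * 4 ^ p)%R) by (specialize (P4 p); nra).
  assert (HL : (1 <= L)%R) by (unfold L; lra).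
  set (d := n - g0 * p).
  assert (Hd : (1 <= Cmod d)%R).
  { assert (E : exists k : nat, (1 <= k)%nat /\ d = k).
    { destruct Hgb as [[-> _]|[-> _]].
      - exists (n - p)%nat. split; [lia|]. unfold d. rewrite minus_INR by lia.
        rewrite RtoC_minus. ring.
      - exists n. split; [lia|]. unfold d. ring. }
    destruct E as (k & Hk & ->). rewrite Cmod_R, Rabs_pos_eq by apply pos_INR.
    apply le_INR in Hk. exact Hk. }
  assert (Nd : d <> 0) by (apply Cmod_gt_0; lra).
  assert (Pd : (0 < / Cmod d <= 1)%R).
  { split; [apply Rinv_0_lt_compat; lra|]. rewrite <- Rinv_1.
    apply Rinv_le_contravar; lra. }
  assert (Hg0 : (Cmod g0 <= 1)%R).
  { destruct Hgb as [[-> _]|[-> _]]; rewrite ?Cmod_1, ?Cmod_0; lra. }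
  assert (PL : (0 < / (8 * L))%R) by (apply Rinv_0_lt_compat; lra).
  assert (EL : (L * / (8 * L) = / 8)%R) by (field; lra).
  exists (/ (8 * L))%R. split; [assumption|]. intros r Hr.
  exists (r * / (8 * L))%R. split; [apply Rmult_lt_0_compat; lra|].
  intros g b Hg Hb.
  set (T := fun u => u - (u ^ n - g * u ^ p - b) / d).
  assert (HLr : (L * r <= / 8)%R) by nra.
  assert (Hr1 : (r <= 1)%R) by nra.
  assert (HT : forall x y : C, (Cmod (x - 1) <= r)%R -> (Cmod (y - 1) <= r)%R ->
     (Cmod (T x - T y) <= / 2 * Cmod (x - y))%R).
  { intros x y Hx Hy.
    assert (Q1 := pow_diff_linear n r x y Hr1 Hx Hy).
    assert (Q2 := pow_diff_linear p r x y Hr1 Hx Hy).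
    set (U := x ^ n - y ^ n - n * (x - y)) in *.
    set (V := x ^ p - y ^ p - p * (x - y)) in *.
    replace (T x - T y) with
      (- / d * (U + (- g * V + - ((g - g0) * (p * (x - y)))))).
    2:{ unfold T, U, V. replace (x - y) with (d * (x - y) / d) at 4 by now field.
        unfold d. field. exact Nd. }
    rewrite Cmod_mult, Cmod_opp, Cmod_inv by assumption.
    set (D := Cmod (x - y)) in *. assert (PD : (0 <= D)%R) by apply Cmod_ge_0.
    assert (S1 := Cmod_triangle U (- g * V + - ((g - g0) * (p * (x - y))))).
    assert (S2 := Cmod_triangle (- g * V) (- ((g - g0) * (p * (x - y))))).
    rewrite Cmod_opp, !Cmod_mult, Cmod_opp, Cmod_R, Rabs_pos_eq in S2 by assumption.
    fold D in S2.
    assert (Gb : (Cmod g <= 2)%R).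
    { replace g with ((g - g0) + g0) by ring.
      eapply Rle_trans; [apply Cmod_triangle|]. nra. }
    assert (X1 : (Cmod g * Cmod V <= 2 * (p * 4 ^ p * r * D))%R)
      by (apply Rmult_le_compat; try apply Cmod_ge_0; assumption).
    assert (X2 : (Cmod (g - g0) * (p * D) <= r * (p * D))%R).
    { apply Rmult_le_compat_r; [now apply Rmult_le_pos|]. nra. }
    assert (X3 : (Cmod (U + (- g * V + - ((g - g0) * (p * (x - y))))) <= / 2 * D)%R).
    { assert (PrD : (0 <= r * D)%R) by (apply Rmult_le_pos; lra).
      assert (X4 : (L * r * D <= / 8 * D)%R) by (now apply Rmult_le_compat_r).
      unfold L in X4. nra. }
    assert (X5 : (0 <= Cmod (U + (- g * V + - ((g - g0) * (p * (x - y))))))%R)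
      by apply Cmod_ge_0.
    nra. }
  assert (Hroot : forall u, u ^ n - g * u ^ p - b = 0 <-> T u = u).
  { intros u. unfold T. split.
    - intros ->. field. exact Nd.
    - intros E.
      replace (u ^ n - g * u ^ p - b)
        with (d * (u - (u - (u ^ n - g * u ^ p - b) / d))) by now field.
      rewrite E. ring. }
  (* Radius r/2 puts the root strictly inside the open disc of radius r, while contraction on the
     whole disc gives uniqueness there. The perturbations of g and b move [T 1] by at most 2 delta
     <= r/4. *)
  destruct (contraction_fixed_point T 1 (r / 2)) as (u & Hu & Tu).
  - intros x y Hx Hy. apply HT; lra.
  - replace (T 1 - 1) with (- / d * (- (g - g0) + - (b - b0))).
    2:{ unfold T. rewrite !Cpow_1_l.
        destruct Hgb as [[-> ->]|[-> ->]]; field; exact Nd. }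
    rewrite Cmod_mult, Cmod_opp, Cmod_inv by assumption.
    assert (S := Cmod_triangle (- (g - g0)) (- (b - b0))).
    rewrite !Cmod_opp in S.
    assert (S0 := Cmod_ge_0 (- (g - g0) + - (b - b0))).
    assert (r * / (8 * L) <= r * / 8)%R.
    { apply Rmult_le_compat_l; [lra|]. apply Rinv_le_contravar; lra. }
    nra.
  - exists u. split.
    + split; [lra|]. now apply Hroot.
    + intros x [Hx Rx]. apply Hroot in Rx.
      assert (Q := HT u x ltac:(lra) ltac:(lra)). rewrite Tu, Rx in Q.
      assert (P := Cmod_ge_0 (u - x)).
      apply Ceq_minus, Cmod_eq_0. lra.
Qed.

(** * Roots of unity *)

Lemma eps_pow (N m : nat) : (0 < N)%nat -> eps N ^ m = Cexp ((0, 2 * PI * m / N)%R).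
Proof.
  intros HN. unfold eps. rewrite <- Cexp_mul_nat. f_equal.
  assert (P : (INR N <> 0)%R) by (apply not_0_INR; lia).
  unfold Cdiv. rewrite <- RtoC_inv by assumption.
  apply injective_projections; simpl; field; assumption.
Qed.

Lemma eps_pow_N (N : nat) : (0 < N)%nat -> eps N ^ N = 1.
Proof.
  intros HN. rewrite eps_pow by assumption.
  assert (P : (INR N <> 0)%R) by (apply not_0_INR; lia).
  replace (2 * PI * N / N)%R with (2 * PI)%R by now field.
  unfold Cexp. simpl. rewrite exp_0, cos_2PI, sin_2PI.
  apply injective_projections; simpl; ring.
Qed.

Lemma eps_neq_0 (N : nat) : eps N <> 0.
Proof. apply Cexp_neq_0. Qed.

Lemma Cmod_eps (N : nat) : (0 < N)%nat -> Cmod (eps N) = 1%R.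
Proof.
  intros HN. rewrite <- (Cpow_1_r (eps N)), eps_pow by assumption.
  rewrite Cmod_Cexp. simpl. apply exp_0.
Qed.

Lemma eps_pow_neq_1 (N m : nat) : (0 < m < N)%nat -> eps N ^ m <> 1.
Proof.
  intros [Hm HN] E. rewrite eps_pow in E by lia.
  assert (PN : (0 < N)%R) by (apply lt_0_INR; lia).
  assert (Pm : (0 < m)%R) by (apply lt_0_INR; lia).
  assert (L : (m < N)%R) by (apply lt_INR; lia).
  set (h := (PI * m / N)%R).
  assert (Hh : (0 < h < PI)%R).
  { assert (PP := PI_RGT_0). unfold h. split.
    - apply Rdiv_lt_0_compat; [apply Rmult_lt_0_compat|]; lra.
    - apply Rmult_lt_reg_r with (1 := PN). unfold Rdiv.
      rewrite Rmult_assoc, Rinv_l by lra. nra. }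
  apply (f_equal Re) in E. unfold Cexp in E. simpl in E.
  rewrite exp_0 in E.
  replace (2 * PI * m / N)%R with (2 * h)%R in E by (unfold h; field; lra).
  rewrite cos_2a_sin in E.
  assert (S := sin_gt_0 h ltac:(lra) ltac:(lra)). nra.
Qed.

Lemma eps_pow_mod (N m : nat) : (0 < N)%nat -> eps N ^ m = eps N ^ (m mod N).
Proof.
  intros HN. rewrite (Nat.div_mod_eq m N) at 1.
  rewrite Cpow_add_r, Cpow_mult_r, eps_pow_N, Cpow_1_l by assumption. ring.
Qed.

(** The place where coprimality acts: by Gauss's lemma N divides e i only if it divides i. *)
Lemma eps_pow_coprime_neq_1 (N e i : nat) : Nat.gcd N e = 1%nat -> (0 < i < N)%nat ->
  (eps N ^ e) ^ i <> 1.
Proof.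
  intros Hg Hi. rewrite <- Cpow_mult_r, eps_pow_mod by lia.
  assert (M : ((e * i) mod N < N)%nat) by (apply Nat.mod_upper_bound; lia).
  destruct (Nat.eq_dec ((e * i) mod N) 0) as [Z|Z].
  - exfalso. apply Nat.Lcm0.mod_divide in Z.
    apply Nat.gauss in Z; [|assumption].
    apply Nat.divide_pos_le in Z; lia.
  - apply eps_pow_neq_1. lia.
Qed.

(** * Orthogonality and extraction of a residue class *)

Lemma geom_sum (z : C) (n : nat) : (z - 1) * csum (fun j => z ^ j) n = z ^ n - 1.
Proof.
  induction n as [|n IH]; [simpl; ring|].
  simpl csum. rewrite Cmult_plus_distr_l, IH, Cpow_S. ring.
Qed.

Lemma csum_root_of_unity (z : C) (N : nat) : z ^ N = 1 -> z <> 1 ->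
  csum (fun j => z ^ j) N = 0.
Proof.
  intros H1 H. assert (Hz : z - 1 <> 0) by now apply Cminus_eq_contra.
  assert (E := geom_sum z N). rewrite H1 in E.
  replace (csum (fun j => z ^ j) N) with ((z - 1) * csum (fun j => z ^ j) N / (z - 1))
    by now field.
  rewrite E. now field.
Qed.

Lemma csum_1 (n : nat) : csum (fun _ => 1) n = n.
Proof.
  induction n as [|n IH]; [reflexivity|]. simpl. now rewrite IH, INRC_S.
Qed.

Lemma csum_single (f : nat -> C) (N k : nat) : (k < N)%nat ->
  (forall i, (i < N)%nat -> i <> k -> f i = 0) -> csum f N = f k.
Proof.
  intros Hk H. replace N with (k + S (N - S k))%nat by lia.
  rewrite csum_add, csum_S_l, Nat.add_0_r.
  rewrite (csum_ext f (fun _ => 0) k), (csum_ext _ (fun _ => 0) (N - S k)), !csum_0.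
  - ring.
  - intros i Hi. apply H; lia.
  - intros i Hi. apply H; lia.
Qed.

(** Orthogonality of characters, for an arbitrary primitive root because the branches produce a
    power of [eps N] rather than [eps N] itself. *)
Lemma csum_primitive_root (w : C) (N k m : nat) : (k < N)%nat -> (m < N)%nat ->
  w <> 0 -> w ^ N = 1 -> (forall i, (0 < i < N)%nat -> w ^ i <> 1) ->
  csum (fun j => (/ w) ^ (j * k) * w ^ (j * m)) N = if Nat.eq_dec m k then RtoC N else 0.
Proof.
  intros Hk Hm W0 WN Wi.
  assert (E : forall j, (/ w) ^ (j * k) * w ^ (j * m) = (/ w ^ k * w ^ m) ^ j).
  { intros j. rewrite !(Nat.mul_comm j), !Cpow_mult_r, Cpow_mult_l, Cpow_inv by assumption.
    reflexivity. }
  rewrite (csum_ext _ (fun j => (/ w ^ k * w ^ m) ^ j)) by auto.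
  assert (Wk : w ^ k <> 0) by now apply Cpow_nz.
  assert (Wm : w ^ m <> 0) by now apply Cpow_nz.
  destruct (Nat.eq_dec m k) as [->|NE].
  - rewrite <- csum_1. apply csum_ext. intros j _.
    replace (/ w ^ k * w ^ k) with (RtoC 1) by now field. apply Cpow_1_l.
  - apply csum_root_of_unity.
    + rewrite Cpow_mult_l, Cpow_inv, <- !Cpow_mult_r by assumption.
      rewrite !(Nat.mul_comm _ N), !Cpow_mult_r, WN, !Cpow_1_l. field.
    + intros Q.
      assert (Q' : w ^ m = w ^ k).
      { replace (w ^ m) with (w ^ k * (/ w ^ k * w ^ m)) by now field.
        rewrite Q. ring. }
      destruct (Nat.lt_ge_cases m k) as [L|L].
      * apply (Wi (k - m)%nat); [lia|].
        replace (w ^ (k - m)) with (w ^ (m + (k - m)) / w ^ m)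
          by (rewrite Cpow_add_r; now field).
        replace (m + (k - m))%nat with k by lia. rewrite Q'. now field.
      * apply (Wi (m - k)%nat); [lia|].
        replace (w ^ (m - k)) with (w ^ (k + (m - k)) / w ^ k)
          by (rewrite Cpow_add_r; now field).
        replace (k + (m - k))%nat with m by lia. rewrite Q'. now field.
Qed.

(** After averaging, each block of N consecutive indices keeps exactly one term, so the block sums
    already are the terms of the subseries. *)
Lemma conv_residue_class (f : nat -> C) (w t : C) (S : nat -> C) (N k : nat) :
  (k < N)%nat -> w <> 0 -> w ^ N = 1 -> (forall i, (0 < i < N)%nat -> w ^ i <> 1) ->
  (forall j, (j < N)%nat -> conv (fun m => f m * (w ^ j * t) ^ m) (S j)) ->
  conv (fun r => f (N * r + k)%nat * t ^ (N * r + k))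
    (/ N * csum (fun j => (/ w) ^ (j * k) * S j) N).
Proof.
  intros Hk W0 WN Wi H.
  assert (HN : RtoC N <> 0) by (apply INRC_neq_0; lia).
  assert (HS := conv_csum (fun j m => (/ w) ^ (j * k) * (f m * (w ^ j * t) ^ m))
                  (fun j => (/ w) ^ (j * k) * S j) N
                  (fun j Hj => conv_scal _ _ _ (H j Hj))).
  apply (conv_scal (/ N)), (conv_mul_index _ _ N) in HS; [|lia].
  eapply conv_ext; [|exact HS]. intros r. cbv beta.
  assert (Ew : forall i j, (w ^ j * t) ^ (N * r + i) = w ^ (j * i) * t ^ (N * r + i)).
  { intros i j. rewrite Cpow_mult_l, <- Cpow_mult_r.
    replace (j * (N * r + i))%nat with (N * (j * r) + j * i)%nat by ring.
    rewrite (Cpow_add_r w), (Cpow_mult_r w N), WN, Cpow_1_l. ring. }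
  rewrite (csum_single _ N k Hk).
  - rewrite (csum_ext _ (fun j => f (N * r + k)%nat * t ^ (N * r + k)
        * ((/ w) ^ (j * k) * w ^ (j * k)))).
    + rewrite csum_scal, csum_primitive_root by assumption.
      destruct (Nat.eq_dec k k); [|lia]. field. exact HN.
    + intros j _. rewrite Ew. ring.
  - intros i Hi NE.
    rewrite (csum_ext _ (fun j => f (N * r + i)%nat * t ^ (N * r + i)
        * ((/ w) ^ (j * k) * w ^ (j * i)))).
    + rewrite csum_scal, csum_primitive_root by assumption.
      destruct (Nat.eq_dec i k); [lia|]. ring.
    + intros j _. rewrite Ew. ring.
Qed.

(** * Gauss's multiplication formula *)

Lemma Cprod_app (s t : list C) : Cprod (s ++ t) = Cprod s * Cprod t.
Proof. induction s as [|x s IH]; simpl; [|rewrite IH]; ring. Qed.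

Lemma Cprod_map_ext (f g : nat -> C) (L : list nat) :
  (forall i, In i L -> f i = g i) -> Cprod (map f L) = Cprod (map g L).
Proof. intros H. f_equal. now apply map_ext_in. Qed.

Lemma Cprod_map_mult (f g : nat -> C) (L : list nat) :
  Cprod (map (fun i => f i * g i) L) = Cprod (map f L) * Cprod (map g L).
Proof. induction L as [|x L IH]; simpl; [|rewrite IH]; ring. Qed.

Lemma Cprod_map_const (x : C) (s n : nat) : Cprod (map (fun _ => x) (seq s n)) = x ^ n.
Proof.
  revert s. induction n as [|n IH]; intros s; simpl; [reflexivity|].
  now rewrite IH.
Qed.

Lemma Cprod_seq (z : C) (n : nat) : Cprod (map (fun i : nat => z + i) (seq 0 n)) = poch z n.
Proof.
  induction n as [|n IH]; [reflexivity|].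
  rewrite seq_S, map_app, Cprod_app, IH. simpl. ring.
Qed.

(** Each step in r adds the n factors z + n r + i = n ((z + i)/n + r). *)
Lemma poch_multiplication (z : C) (n r : nat) : (0 < n)%nat ->
  poch z (n * r) = (RtoC n ^ n) ^ r
    * Cprod (map (fun i : nat => poch ((z + i) / n) r) (seq 0 n)).
Proof.
  intros Hn. assert (N0 : RtoC n <> 0) by (apply INRC_neq_0; lia).
  induction r as [|r IH].
  - rewrite Nat.mul_0_r, (Cprod_map_ext _ (fun _ => 1)) by auto.
    rewrite Cprod_map_const, Cpow_1_l. simpl. ring.
  - rewrite Nat.mul_succ_r, poch_add, IH, Cpow_S.
    change (fun i : nat => poch ((z + i) / n) (S r))
      with (fun i : nat => poch ((z + i) / n) r * ((z + i) / n + r)).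
    rewrite Cprod_map_mult.
    replace (poch (z + (n * r)%nat) n)
      with (RtoC n ^ n * Cprod (map (fun i : nat => (z + i) / n + r) (seq 0 n))); [ring|].
    rewrite <- Cprod_seq, <- (Cprod_map_const n 0), <- Cprod_map_mult.
    apply Cprod_map_ext. intros i _. rewrite INRC_mul. now field.
Qed.

Lemma seq_shift_map (f : nat -> C) (n : nat) :
  map f (seq 1 n) = map (fun i => f (S i)) (seq 0 n).
Proof. now rewrite <- seq_shift, map_map. Qed.

Lemma Cprod_filter (f : nat -> C) (j n s : nat) : (s <= j < s + n)%nat ->
  Cprod (map f (seq s n))
  = f j * Cprod (map f (filter (fun i => negb (i =? j)%nat) (seq s n))).
Proof.
  intros Hj.
  replace n with ((j - s) + S (n - S (j - s)))%nat at 1 2 by lia.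
  rewrite seq_app. simpl seq. replace (s + (j - s))%nat with j by lia.
  rewrite filter_app. simpl filter. rewrite Nat.eqb_refl. simpl negb. cbv iota.
  assert (F : forall L, ~ In j L -> filter (fun i => negb (i =? j)%nat) L = L).
  { induction L as [|x L IH]; intros NI; [reflexivity|]. simpl.
    destruct (Nat.eqb_spec x j) as [->|]; [destruct NI; now left|].
    simpl. rewrite IH; [reflexivity|]. intros I. apply NI. now right. }
  rewrite !F by (rewrite in_seq; lia).
  rewrite !map_app, !Cprod_app. simpl. ring.
Qed.

(* The omitted lower parameter is [(n - k)/n + k/n = 1]; its Pochhammer symbol is
   the factor [(1)_r] in the denominator of a hypergeometric series. *)
Lemma fact_multiplication (n k r : nat) : (k < n)%nat ->
  poch 1 (n * r + k) = poch 1 k * (RtoC n ^ n) ^ r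
    * (Cprod (map (fun i : nat => poch (i / n + k / n) r)
               (filter (fun i => negb (i =? n - k)%nat) (seq 1 n)))
       * poch 1 r).
Proof.
  intros Hk. assert (N0 : RtoC n <> 0) by (apply INRC_neq_0; lia).
  rewrite Nat.add_comm, poch_add, poch_multiplication by lia.
  replace (Cprod (map (fun i : nat => poch ((1 + k + i) / n) r) (seq 0 n)))
    with (Cprod (map (fun i : nat => poch (i / n + k / n) r) (seq 1 n))).
  - rewrite (Cprod_filter _ (n - k)) by lia.
    replace ((n - k)%nat / n + k / n) with (RtoC 1).
    + ring.
    + rewrite minus_INR, RtoC_minus by lia. now field.
  - rewrite seq_shift_map. apply Cprod_map_ext. intros i _. f_equal.
    rewrite INRC_S. now field.
Qed.

(** * Residue classes of coefficients as hypergeometric terms *)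

Lemma pochZ_opp (z : C) (s : nat) : pochZ z (- Z.of_nat s) = / poch (z - s) s.
Proof.
  destruct s as [|s].
  - simpl. field.
  - simpl Z.of_nat. simpl Z.opp. unfold pochZ.
    now rewrite SuccNat2Pos.id_succ.
Qed.

Lemma pochZ_defined_opp (z : C) (s : nat) :
  pochZ_defined z (- Z.of_nat s) -> poch (z - s) s <> 0.
Proof.
  intros H. apply poch_neq_0. intros i Hi.
  replace (z - s + i) with (z - (s - i)%nat)
    by (rewrite minus_INR, RtoC_minus by lia; ring).
  apply H. lia.
Qed.

Lemma poch_reflect (z : C) (s : nat) : poch (z - s) s = (- (1)) ^ s * poch (1 - z) s.
Proof.
  induction s as [|s IH]; [simpl; ring|].
  rewrite poch_S_l. replace (z - S s + 1) with (z - s) by (rewrite INRC_S; ring).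
  rewrite IH, Cpow_S, INRC_S. simpl. ring.
Qed.

Lemma Cpow_div (x y : C) (r : nat) : y <> 0 -> (x / y) ^ r = x ^ r / y ^ r.
Proof. intros H. unfold Cdiv. now rewrite Cpow_mult_l, Cpow_inv. Qed.

Lemma Cprod_neq_0 (L : list C) : (forall x, In x L -> x <> 0) -> Cprod L <> 0.
Proof.
  induction L as [|x L IH]; intros H; simpl; [exact C1_nz|].
  apply Cmult_neq_0; [apply H; now left|]. apply IH. intros y Hy. apply H. now right.
Qed.

Lemma m1_pow_sq (k : nat) : (- (1)) ^ k * (- (1)) ^ k = 1.
Proof.
  rewrite <- Cpow_mult_l. replace (- (1) * - (1)) with (RtoC 1) by ring. apply Cpow_1_l.
Qed.

Lemma m1_pow_inv (k : nat) : / (- (1)) ^ k = (- (1)) ^ k.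
Proof.
  assert (N : (- (1)) ^ k <> 0).
  { intros Q. apply C1_nz. rewrite <- (m1_pow_sq k), Q. ring. }
  transitivity ((- (1)) ^ k * (- (1)) ^ k * / (- (1)) ^ k).
  - rewrite m1_pow_sq. ring.
  - now field.
Qed.

Definition hyp_coef (upper lower : list C) (r : nat) : C :=
  Cprod (map (fun b => poch b r) upper)
    / (Cprod (map (fun b => poch b r) lower) * poch 1 r).

Lemma lower_ok_poch (L : list C) (r : nat) (b : C) :
  lower_ok L -> In b L -> poch b r <> 0.
Proof. intros H I. apply poch_neq_0. intros i _. now apply (lower_ok_add L). Qed.

Lemma lower_ok_app (L M : list C) : lower_ok (L ++ M) -> lower_ok L /\ lower_ok M.
Proof.
  intros H. split; intros b Hb; apply H, in_app_iff; auto.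
Qed.

Lemma Cprod_poch_neq_0 (L : list C) (r : nat) : lower_ok L ->
  Cprod (map (fun b => poch b r) L) <> 0.
Proof.
  intros H. apply Cprod_neq_0. intros x Hx. apply in_map_iff in Hx.
  destruct Hx as (b & <- & Hb). now apply (lower_ok_poch L).
Qed.

(** The prefactor is the inverse of [coef l a c beta k], normalising the term r = 0 to 1. With z = a
    - l + beta k, raising the index by q r moves the base of the symbol up by p r and lengthens it
    by q r; the symbol is thus (z)_(l+k+nr)/(z)_(pr), which Gauss's formula splits into n upper and
    p lower parameters. *)
Lemma coef_zero (p q l : nat) (a c : C) (k r : nat) :
  let beta := p / q in
  (1 <= p)%nat -> (k < q)%nat ->
  poch (a - l) l <> 0 -> (forall m : nat, a + c - l + beta * m <> 0) ->
  poch (a - l + beta * k) (l + k) <> 0 ->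
  lower_ok (lower_zero p q l a c k) ->
  (- (1)) ^ k * poch 1 k / poch (a - l + beta * k) (l + k)
    * (a + c - l + beta * k) * poch (a - l) l / (a + c - l)
    * coef l a c beta (q * r + k)
  = hyp_coef (upper_zero p q l a c k) (lower_zero p q l a c k) r * disc p q ^ r.
Proof.
  intros beta Hp Hk Ha HE Hz HL.
  set (n := (p + q)%nat).
  assert (p0 : RtoC p <> 0) by (apply INRC_neq_0; lia).
  assert (q0 : RtoC q <> 0) by (apply INRC_neq_0; lia).
  assert (n0 : RtoC n <> 0) by (apply INRC_neq_0; lia).
  set (z := a - l + beta * k) in *. set (E := a + c - l) in *.
  (* The last upper parameter: E + beta m at m = q r + k equals p (x + r), so the quotient in [coef]
     yields the pair x over x + 1. *)
  set (x := (E + beta * k) / p).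
  unfold lower_zero in HL.
  apply lower_ok_app in HL. destruct HL as [HL1 HL2].
  apply lower_ok_app in HL2. destruct HL2 as [HL2 HL3].
  assert (Hx : forall i : nat, x + i <> 0).
  { intros i Q. apply (HE (q * i + k)%nat).
    replace (E + beta * (q * i + k)%nat) with (p * (x + i)).
    - rewrite Q. ring.
    - unfold x, beta. rewrite INRC_add, INRC_mul. field. auto. }
  assert (X0 : E + beta * k <> 0) by apply HE.
  assert (E0 : E <> 0) by (specialize (HE O); now rewrite INRC_0, Cmult_0_r, Cplus_0_r in HE).
  unfold hyp_coef, upper_zero, lower_zero. fold n.
  rewrite !map_app, !Cprod_app, !map_map.
  set (P := Cprod (map _ (seq 0 p))). set (Q := Cprod (map _ (filter _ _))).
  set (U := Cprod (map _ (seq 0 n))).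
  assert (P0 : P <> 0).
  { unfold P. rewrite <- (map_map (fun i : nat => (a - l + i) / p + k / q) (fun b => poch b r)).
    now apply Cprod_poch_neq_0. }
  assert (Q0 : Q <> 0).
  { unfold Q. rewrite <- (map_map (fun i : nat => i / q + k / q) (fun b => poch b r)).
    now apply Cprod_poch_neq_0. }
  assert (F := fact_multiplication q k r Hk). fold Q in F.
  assert (M1 := poch_multiplication z p r ltac:(lia)).
  replace (Cprod (map (fun i : nat => poch ((z + i) / p) r) (seq 0 p))) with P in M1.
  2:{ apply Cprod_map_ext. intros i _. f_equal. unfold z, beta. field. auto. }
  assert (M2 := poch_multiplication (z + (l + k)%nat) n r ltac:(lia)).
  replace (Cprod (map (fun i : nat => poch ((z + (l + k)%nat + i) / n) r) (seq 0 n)))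
    with U in M2.
  2:{ apply Cprod_map_ext. intros i _. f_equal. unfold z, beta, n in *.
      rewrite INRC_add in *. rewrite INRC_add. field. auto. }
  assert (S1 : poch z (p * r) * poch (z + (p * r)%nat) (l + (q * r + k))
             = poch z (l + k) * poch (z + (l + k)%nat) (n * r)).
  { rewrite <- !poch_add. f_equal. unfold n. ring. }
  simpl map. simpl Cprod.
  replace ((a + c - l) / p + k / q) with x
    by (unfold x, E, beta; field; auto).
  replace ((a + c - l + p) / p + k / q) with (x + 1)
    by (unfold x, E, beta; field; auto).
  assert (R := poch_succ_ratio x r Hx).
  assert (Y0 : poch x r <> 0) by (apply poch_neq_0; auto).
  assert (Y1 : poch (x + 1) r <> 0).
  { apply poch_neq_0. intros i _.
    replace (x + 1 + i) with (x + S i) by (rewrite INRC_S; ring). apply Hx. }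
  assert (Xn : x <> 0) by (specialize (Hx O); now rewrite INRC_0, Cplus_0_r in Hx).
  assert (R' : poch x r / poch (x + 1) r = x / (x + r)).
  { replace (x / (x + r)) with (/ ((x + r) / x)) by (field; split; auto).
    rewrite <- R. field. auto. }
  unfold coef. fold E.
  replace (a - l + beta * (q * r + k)%nat) with (z + (p * r)%nat)
    by (unfold z, beta; rewrite INRC_add, !INRC_mul; field; auto).
  replace (E + beta * (q * r + k)%nat) with (p * (x + r))
    by (unfold x, beta; rewrite INRC_add, !INRC_mul; field; auto).
  replace (E + beta * k) with (p * x) by (unfold x; field; auto).
  rewrite F.
  unfold disc. fold n. change (INR (p + q)) with (INR n).
  assert (pp : (RtoC p ^ p) ^ r <> 0) by (do 2 apply Cpow_nz; assumption).
  assert (qq : (RtoC q ^ q) ^ r <> 0) by (do 2 apply Cpow_nz; assumption).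
  rewrite Cpow_div by (apply Cmult_neq_0; apply Cpow_nz; assumption).
  rewrite !Cpow_mult_l.
  replace (poch (z + (p * r)%nat) (l + (q * r + k)))
    with (poch z (l + k) * ((RtoC n ^ n) ^ r * U) / ((RtoC p ^ p) ^ r * P)).
  2:{ rewrite <- M1, <- M2, <- S1. field. rewrite M1. now apply Cmult_neq_0. }
  replace (U * (poch x r * 1) / (P * (Q * (poch (x + 1) r * 1)) * poch 1 r))
    with (U / (P * Q * poch 1 r) * (poch x r / poch (x + 1) r)).
  2:{ field. repeat split; auto. apply fact_poch_neq_0. }
  rewrite R', Cpow_add_r, Cpow_mult_r.
  assert (F1 := fact_poch_neq_0 k). assert (F2 := fact_poch_neq_0 r).
  assert (Xr := Hx r).
  replace ((- (1)) ^ k * poch 1 k / poch z (l + k) * (p * x) * poch (a - l) l / E *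
     (((- (1)) ^ q) ^ r * (- (1)) ^ k *
     (poch z (l + k) * ((RtoC n ^ n) ^ r * U) / ((RtoC p ^ p) ^ r * P) / poch (a - l) l) *
     (E / (p * (x + r))) / (poch 1 k * (RtoC q ^ q) ^ r * (Q * poch 1 r))))
   with (((- (1)) ^ k * (- (1)) ^ k) * (((- (1)) ^ q) ^ r * ((RtoC n ^ n) ^ r * U) / ((RtoC p ^ p) ^ r * P)
       * (x / (x + r)) / ((RtoC q ^ q) ^ r * (Q * poch 1 r)))).
  2:{ field. repeat split; auto. }
  rewrite m1_pow_sq. field. repeat split; auto.
Qed.

(** With negative beta the base moves down to z - p r, so the symbol starts with the p r factors
    below z. Reflected, they become (1 - z)_(pr) and supply p upper instead of p lower
    parameters. *)
Lemma coef_infty (p q l : nat) (a c : C) (k r : nat) :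
  let n := (p + q)%nat in
  let beta := - (p / n) in
  (1 <= p)%nat -> (1 <= q)%nat -> (k < n)%nat ->
  poch (a - l) l <> 0 -> (forall m : nat, a + c - l + beta * m <> 0) ->
  poch (a - l + beta * k) (l + k) <> 0 ->
  lower_ok (lower_infty p q l a c k) ->
  (- (1)) ^ k * poch 1 k / poch (a - l + beta * k) (l + k)
    * (a + c - l + beta * k) * poch (a - l) l / (a + c - l)
    * coef l a c beta (n * r + k)
  = hyp_coef (upper_infty p q l a c k) (lower_infty p q l a c k) r * (/ disc p q) ^ r.
Proof.
  intros n beta Hp Hq Hk Ha HE Hz HL.
  assert (p0 : RtoC p <> 0) by (apply INRC_neq_0; lia).
  assert (q0 : RtoC q <> 0) by (apply INRC_neq_0; lia).
  assert (n0 : RtoC n <> 0) by (apply INRC_neq_0; lia).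
  set (z := a - l + beta * k) in *. set (E := a + c - l) in *.
  set (x := - (E + beta * k) / p).
  unfold lower_infty in HL. fold n in HL.
  apply lower_ok_app in HL. destruct HL as [HL2 HL3].
  assert (Hx : forall i : nat, x + i <> 0).
  { intros i Q. apply (HE (n * i + k)%nat).
    replace (E + beta * (n * i + k)%nat) with (- p * (x + i)).
    - rewrite Q. ring.
    - unfold x, beta. rewrite INRC_add, INRC_mul. field. auto. }
  assert (X0 : E + beta * k <> 0) by apply HE.
  assert (E0 : E <> 0) by (specialize (HE O); now rewrite INRC_0, Cmult_0_r, Cplus_0_r in HE).
  unfold hyp_coef, upper_infty, lower_infty. fold n.
  rewrite !map_app, !Cprod_app, !map_map.
  set (P := Cprod (map _ (seq 1 p))). set (Q := Cprod (map _ (filter _ _))).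
  set (U := Cprod (map _ (seq 0 q))).
  assert (Q0 : Q <> 0).
  { unfold Q. rewrite <- (map_map (fun i : nat => i / n + k / n) (fun b => poch b r)).
    now apply Cprod_poch_neq_0. }
  assert (F := fact_multiplication n k r Hk). fold Q in F.
  assert (M1 := poch_multiplication (1 - z) p r ltac:(lia)).
  replace (Cprod (map (fun i : nat => poch ((1 - z + i) / p) r) (seq 0 p))) with P in M1.
  2:{ unfold P. rewrite seq_shift_map.
      apply Cprod_map_ext. intros i _. f_equal. unfold z, beta. rewrite INRC_S.
      field. auto. }
  assert (M2 := poch_multiplication (z + (l + k)%nat) q r ltac:(lia)).
  replace (Cprod (map (fun i : nat => poch ((z + (l + k)%nat + i) / q) r) (seq 0 q)))
    with U in M2.
  2:{ apply Cprod_map_ext. intros i _. f_equal. unfold z, beta, n in *.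
      rewrite INRC_add in *. rewrite INRC_add. field. auto. }
  assert (S1 : poch (z - (p * r)%nat) (l + (n * r + k))
             = (- (1)) ^ (p * r) * poch (1 - z) (p * r) * poch z (l + k)
               * poch (z + (l + k)%nat) (q * r)).
  { rewrite <- poch_reflect.
    replace (l + (n * r + k))%nat with (p * r + ((l + k) + q * r))%nat
      by (unfold n; ring).
    rewrite !(poch_add _ _ (_ + _)), (poch_add _ (l + k)).
    replace (z - (p * r)%nat + (p * r)%nat) with z by ring. ring. }
  simpl map. simpl Cprod.
  replace ((- a - c + l) / p + k / n) with x
    by (unfold x, E, beta; field; auto).
  replace ((- a - c + l + p) / p + k / n) with (x + 1)
    by (unfold x, E, beta; field; auto).
  assert (R := poch_succ_ratio x r Hx).
  assert (Y0 : poch x r <> 0) by (apply poch_neq_0; auto).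
  assert (Y1 : poch (x + 1) r <> 0).
  { apply poch_neq_0. intros i _.
    replace (x + 1 + i) with (x + S i) by (rewrite INRC_S; ring). apply Hx. }
  assert (Xn : x <> 0) by (specialize (Hx O); now rewrite INRC_0, Cplus_0_r in Hx).
  assert (R' : poch x r / poch (x + 1) r = x / (x + r)).
  { replace (x / (x + r)) with (/ ((x + r) / x)) by (field; split; auto).
    rewrite <- R. field. auto. }
  unfold coef. fold E.
  replace (a - l + beta * (n * r + k)%nat) with (z - (p * r)%nat)
    by (unfold z, beta; rewrite INRC_add, !INRC_mul; field; auto).
  replace (E + beta * (n * r + k)%nat) with (- p * (x + r))
    by (unfold x, beta; rewrite INRC_add, !INRC_mul; field; auto).
  replace (E + beta * k) with (- p * x) by (unfold x; field; auto).
  rewrite F, S1, M1, M2.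
  unfold disc. fold n. change (INR (p + q)) with (INR n).
  assert (nn : (RtoC n ^ n) ^ r <> 0) by (do 2 apply Cpow_nz; assumption).
  assert (m1 : forall i, (- (1)) ^ i <> 0).
  { intros i T. apply C1_nz. rewrite <- (m1_pow_sq i), T. ring. }
  assert (pq0 : RtoC p ^ p * RtoC q ^ q <> 0)
    by (apply Cmult_neq_0; apply Cpow_nz; assumption).
  assert (n1 : RtoC n ^ n <> 0) by (now apply Cpow_nz).
  replace (/ ((- (1)) ^ q * RtoC n ^ n / (RtoC p ^ p * RtoC q ^ q)))
    with ((- (1)) ^ q * (RtoC p ^ p * RtoC q ^ q) / RtoC n ^ n).
  2:{ rewrite <- (m1_pow_inv q) at 1. field.
      repeat split; auto; apply Cpow_nz; assumption. }
  rewrite Cpow_div, !Cpow_mult_l by assumption.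
  replace (P * (U * (poch x r * 1)) / (Q * (poch (x + 1) r * 1) * poch 1 r))
    with (P * U / (Q * poch 1 r) * (poch x r / poch (x + 1) r)).
  2:{ field. repeat split; auto. apply fact_poch_neq_0. }
  (* The sign (-1)^(nr) of [coef] and the sign (-1)^(pr) of the reflection leave that of [disc]. *)
  assert (Sg : ((- (1)) ^ q) ^ r = (- (1)) ^ (n * r) * (- (1)) ^ (p * r)).
  { unfold n. rewrite Nat.mul_add_distr_r, Cpow_add_r, <- Cpow_mult_r.
    replace ((- (1)) ^ (p * r) * (- (1)) ^ (q * r) * (- (1)) ^ (p * r))
      with ((- (1)) ^ (p * r) * (- (1)) ^ (p * r) * (- (1)) ^ (q * r)) by ring.
    rewrite m1_pow_sq. ring. }
  rewrite R', Sg, Cpow_add_r.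
  assert (F1 := fact_poch_neq_0 k). assert (F2 := fact_poch_neq_0 r).
  assert (Xr := Hx r).
  set (sk := (- (1)) ^ k). set (sn := (- (1)) ^ (n * r)). set (sp := (- (1)) ^ (p * r)).
  assert (ssk : sk * sk = 1) by apply m1_pow_sq.
  set (A := (RtoC p ^ p) ^ r). set (B := (RtoC q ^ q) ^ r).
  set (D := (RtoC n ^ n) ^ r) in *. set (zz := poch z (l + k)) in *.
  set (al := poch (a - l) l) in *.
  transitivity ((sk * sk) * (sn * sp * (A * P) * (B * U) * (x / (x + r)) / (D * (Q * poch 1 r)))).
  - field. repeat split; auto.
  - rewrite ssk. field. repeat split; auto.
Qed.

(* [t ^ k] is kept out of the terms because [t] may vanish. *)
Lemma hyp_of_residue_class (f : nat -> C) (upper lower : list C) (K D t X : C)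
  (N k : nat) :
  (forall r, K * f (N * r + k)%nat = hyp_coef upper lower r * D ^ r) ->
  conv (fun r => f (N * r + k)%nat * t ^ (N * r + k)) X ->
  t ^ k * hyp upper lower (D * t ^ N) = K * X.
Proof.
  intros H HX.
  assert (E : forall r, K * (f (N * r + k)%nat * t ^ (N * r + k))
     = t ^ k * (hyp_coef upper lower r * (D * t ^ N) ^ r)).
  { intros r. rewrite Cmult_assoc, H, Cpow_add_r, Cpow_mult_l, <- Cpow_mult_r. ring. }
  assert (HK := conv_scal K _ _ HX).
  destruct (Ceq_dec (t ^ k) 0) as [Z|Z].
  - rewrite Z, Cmult_0_l. eapply conv_unique; [|exact HK].
    apply (conv_ext (fun _ => 0)).
    + intros r. cbv beta. rewrite E, Z. ring.
    + apply is_lim_seq_ext with (fun _ => 0%R); [|apply is_lim_seq_const].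
      intros i. rewrite csum_0. replace (0 - 0) with (RtoC 0) by ring.
      now rewrite Cmod_0.
  - rewrite (hyp_conv upper lower (D * t ^ N) (/ t ^ k * (K * X))); [now field|].
    eapply conv_ext; [|apply (conv_scal (/ t ^ k) _ _ HK)].
    intros r. cbv beta. rewrite E.
    transitivity (hyp_coef upper lower r * (D * t ^ N) ^ r); [now field|reflexivity].
Qed.

Lemma sum_n_m_csum (f : nat -> C) (n : nat) :
  (1 <= n)%nat -> sum_n_m f 1 n = csum (fun j => f (S j)) n.
Proof.
  intros Hn. induction n as [|n IH]; [lia|].
  destruct n as [|n].
  - rewrite sum_n_n. simpl. ring.
  - rewrite sum_n_Sm by lia. rewrite IH by lia. reflexivity.
Qed.

(** * Branches of the trinomial root *)

Lemma Rpower_root (g : R) (N : nat) : (0 < g)%R -> (0 < N)%nat ->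
  let h := Rpower g (1 / N) in
  (0 < h)%R /\ (h ^ N = g)%R /\ (forall e : nat, Rpower g (- (e / N)) = / h ^ e)%R.
Proof.
  intros Hg HN h. assert (Ph : (0 < h)%R) by apply exp_pos.
  assert (N0 : (INR N <> 0)%R) by (apply not_0_INR; lia).
  split; [exact Ph|]. split.
  - rewrite <- Rpower_pow by assumption. unfold h. rewrite Rpower_mult.
    replace (1 / N * N)%R with 1%R by now field. now apply Rpower_1.
  - intros e. rewrite Rpower_Ropp. f_equal.
    rewrite <- Rpower_pow by assumption. unfold h. rewrite Rpower_mult.
    f_equal. now field.
Qed.

Lemma RtoC_neq_0 (x : R) : (0 < x)%R -> RtoC x <> 0.
Proof. intros H Q. apply RtoC_inj in Q. lra. Qed.

(** The substitution x = ce u, after which the trinomial is divided by ce^n, moves every center to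
    1. *)
Lemma root_near_scale (n p : nat) (g beta g' b' ce : C) (r : R) (x : C) :
  ce <> 0 -> g * ce ^ p = ce ^ n * g' -> beta = ce ^ n * b' ->
  root_near n p g beta ce r x <->
  (Cmod (x / ce - 1) < r / Cmod ce)%R /\ (x / ce) ^ n - g' * (x / ce) ^ p - b' = 0.
Proof.
  intros H Hg Hb.
  assert (P : (0 < Cmod ce)%R) by now apply Cmod_gt_0.
  assert (Nn : ce ^ n <> 0) by now apply Cpow_nz.
  unfold root_near. set (u := x / ce).
  assert (Hx : x = ce * u) by (unfold u; now field).
  clearbody u. subst x. rewrite !Cpow_mult_l.
  replace (ce * u - ce) with (ce * (u - 1)) by ring.
  replace (ce ^ n * u ^ n - g * (ce ^ p * u ^ p) - beta)
    with (ce ^ n * (u ^ n - g' * u ^ p - b')).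
  2:{ rewrite (Cmult_assoc g), Hg, Hb. ring. }
  rewrite Cmod_mult. split; intros [A B]; split.
  - apply Rmult_lt_reg_l with (1 := P). unfold Rdiv.
    rewrite (Rmult_comm r), <- Rmult_assoc, Rinv_r, Rmult_1_l by lra. exact A.
  - replace (u ^ n - g' * u ^ p - b')
      with (/ ce ^ n * (ce ^ n * (u ^ n - g' * u ^ p - b'))) by now field.
    rewrite B. ring.
  - apply Rmult_lt_compat_l with (1 := P) in A. unfold Rdiv in A.
    rewrite (Rmult_comm r), <- Rmult_assoc, Rinv_r, Rmult_1_l in A by lra. exact A.
  - rewrite B. ring.
Qed.

Lemma exists_unique_scale (ce : C) (Q : C -> Prop) : ce <> 0 ->
  (exists! u, Q u) -> exists! x, Q (x / ce).
Proof.
  intros H (u & Hu & U). exists (ce * u). split.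
  - now replace (ce * u / ce) with u by now field.
  - intros x Hx. rewrite (U _ Hx). now field.
Qed.

Lemma exists_unique_iff (P Q : C -> Prop) :
  (forall x, P x <-> Q x) -> (exists! x, Q x) -> exists! x, P x.
Proof.
  intros H (x & Hx & U). exists x. split; [now apply H|].
  intros y Hy. apply U. now apply H.
Qed.

Lemma Cmod_lt_of_pow (z : C) (d : R) (N : nat) : (0 < d)%R ->
  (Cmod (z ^ N) < d ^ N)%R -> (Cmod z < d)%R.
Proof.
  intros Hd H. rewrite Cmod_pow in H. apply Rnot_le_lt. intros L.
  assert (Q : (d ^ N <= Cmod z ^ N)%R) by (apply pow_incr; lra). lra.
Qed.

Lemma disc_neq_0 (p q : nat) : (1 <= p)%nat -> (1 <= q)%nat -> disc p q <> 0.
Proof.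
  intros Hp Hq. unfold disc, Cdiv.
  assert (p0 : RtoC p <> 0) by (apply INRC_neq_0; lia).
  assert (q0 : RtoC q <> 0) by (apply INRC_neq_0; lia).
  assert (n0 : RtoC (p + q)%nat <> 0) by (apply INRC_neq_0; lia).
  assert (m0 : - (1) <> 0).
  { intros Q. apply C1_nz. replace (RtoC 1) with (- - (1)) by ring. rewrite Q. ring. }
  assert (D : RtoC p ^ p * RtoC q ^ q <> 0)
    by (apply Cmult_neq_0; now apply Cpow_nz).
  repeat apply Cmult_neq_0; try now apply Cpow_nz.
  intros Q. apply C1_nz. rewrite <- (Cinv_r _ D), Q. ring.
Qed.

Lemma pochZ_prefactor (l k : nat) (a w E F : C) :
  pochZ_defined a (- Z.of_nat l) -> E <> 0 ->
  pochZ_defined w (- Z.of_nat l - Z.of_nat k) ->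
  (- (1)) ^ k * poch 1 k * pochZ w (- Z.of_nat l - Z.of_nat k) * F
    / (pochZ a (- Z.of_nat l) * E)
  = (- (1)) ^ k * poch 1 k / poch (w - (l + k)%nat) (l + k) * F * poch (a - l) l / E.
Proof.
  replace (- Z.of_nat l - Z.of_nat k)%Z with (- Z.of_nat (l + k))%Z by lia.
  intros H1 HE H2. apply pochZ_defined_opp in H1, H2.
  rewrite !pochZ_opp. field. auto.
Qed.

(* The value attached to the branch [u j] is the full series at [w^j t]; averaging
   against the [j k]-th powers of [/ w] keeps the indices congruent to [k]. *)
Lemma branch_average (l N e k : nat) (a c beta w t : C) (u : nat -> C) :
  (k < N)%nat -> w <> 0 -> w ^ N = 1 -> (forall i, (0 < i < N)%nat -> w ^ i <> 1) ->
  (forall j, (j < N)%nat ->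
     conv (fun m => coef l a c beta m * ((1 - / u j ^ N) * u j ^ e) ^ m)
       (principal_pow (u j) (- (N * a)) * G l (- a) (- beta) (- c) (u j ^ N))) ->
  (forall j, (j < N)%nat -> (1 - / u j ^ N) * u j ^ e = w ^ j * t) ->
  conv (fun r => coef l a c beta (N * r + k) * t ^ (N * r + k))
    (/ N * csum (fun j => (/ w) ^ (j * k)
       * (principal_pow (u j) (- (N * a)) * G l (- a) (- beta) (- c) (u j ^ N))) N).
Proof.
  intros Hk W0 WN Wi HS Hu.
  apply (conv_residue_class (coef l a c beta) w t
    (fun j => principal_pow (u j) (- (N * a)) * G l (- a) (- beta) (- c) (u j ^ N)));
    try assumption.
  intros j Hj. rewrite <- Hu by assumption. now apply HS.
Qed.

(** * Assembly of the expansions near 0 and near infinity *)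

Theorem theorem4p6 (p q l : nat) (a c : C)
  (Hp : (1 <= p)%nat) (Hq : (1 <= q)%nat) (Hpq : Nat.gcd p q = 1%nat)
  (Hl : l = 0%nat \/ l = 1%nat) :
  let n := (p + q)%nat in
  (admissible_zero p q l a c ->
   forall g : R, (0 < g)%R ->
   exists r0 : R, (0 < r0)%R /\ forall r : R, (0 < r <= r0)%R ->
   exists delta : R, (0 < delta)%R /\
   forall zeta beta : C, (Cmod zeta < delta)%R ->
     zeta = disc p q * beta ^ q / g ^ n ->
     let near (j : nat) :=
       root_near n p g beta (/ eps q ^ (j - 1) * Rpower g (1 / q)) r in
     (forall j : nat, (1 <= j <= q)%nat -> exists! x : C, near j x) /\
     forall x : nat -> C, (forall j : nat, (1 <= j <= q)%nat -> near j (x j)) ->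
     forall zeta_1q disc_1q : C,
       zeta_1q ^ q = zeta -> disc_1q ^ q = disc p q ->
       zeta_1q = disc_1q * Rpower g (- (n / q)) * beta ->
     forall k : nat, (k < q)%nat ->
       zeta_1q ^ k * hyp (upper_zero p q l a c k) (lower_zero p q l a c k) zeta
       = (- (1)) ^ k * poch 1 k
         * pochZ (a + n * k / q) (- Z.of_nat l - Z.of_nat k)
         * (a + c - l + p * k / q)
         / (pochZ a (- Z.of_nat l) * (a + c - l))
         * disc_1q ^ k
         * (1 / q * sum_n_m (fun j : nat =>
              (/ eps q ^ n) ^ ((j - 1) * k)
              * principal_pow (eps q ^ (j - 1) * Rpower g (- (1 / q)) * x j)
                              (- (q * a))
              * G l (- a) (- (p / q)) (- c) (/ g * x j ^ q)) 1 q))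
  /\
  (admissible_infty p q l a c ->
   forall beta : R, (0 < beta)%R ->
   exists r0 : R, (0 < r0)%R /\ forall r : R, (0 < r <= r0)%R ->
   exists M : R, (0 < M)%R /\
   forall zeta g : C, (M < Cmod zeta)%R ->
     zeta = disc p q * beta ^ q / g ^ n ->
     let near (j : nat) :=
       root_near n p g beta (/ eps n ^ (j - 1) * Rpower beta (1 / n)) r in
     (forall j : nat, (1 <= j <= n)%nat -> exists! x : C, near j x) /\
     forall x : nat -> C, (forall j : nat, (1 <= j <= n)%nat -> near j (x j)) ->
     forall zeta_m1n disc_m1n : C,
       zeta_m1n ^ n = / zeta -> disc_m1n ^ n = / disc p q ->
       zeta_m1n = disc_m1n * Rpower beta (- (q / n)) * g ->
     forall k : nat, (k < n)%nat ->
       zeta_m1n ^ k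
         * hyp (upper_infty p q l a c k) (lower_infty p q l a c k) (/ zeta)
       = (- (1)) ^ k * poch 1 k
         * pochZ (a + q * k / n) (- Z.of_nat l - Z.of_nat k)
         * (a + c - l - p * k / n)
         / (pochZ a (- Z.of_nat l) * (a + c - l))
         * disc_m1n ^ k
         * (1 / n * sum_n_m (fun j : nat =>
              (/ eps n ^ q) ^ ((j - 1) * k)
              * principal_pow (eps n ^ (j - 1) * Rpower beta (- (1 / n)) * x j)
                              (- (n * a))
              * G l (- a) (p / n) (- c) (/ beta * x j ^ n)) 1 n)).
Proof.
  intros n. split.
  - intros (Ha & HE & HGl & Hadm) g Hg.
    assert (p0 : RtoC p <> 0) by (apply INRC_neq_0; lia).
    assert (q0 : RtoC q <> 0) by (apply INRC_neq_0; lia).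
    assert (Hal := pochZ_defined_opp _ _ Ha).
    destruct (Rpower_root g q Hg Hq) as (Ph & hq & hR).
    set (h := Rpower g (1 / q)) in *.
    assert (h0 : RtoC h <> 0) by now apply RtoC_neq_0.
    assert (hq' : RtoC h ^ q = g) by now rewrite <- RtoC_pow, hq.
    assert (Hn : RtoC n = RtoC p + q) by apply INRC_add.
    assert (Hb0 : RtoC p / q <> 0).
    { intros Q. apply p0. replace (RtoC p) with (p / q * q) by now field.
      rewrite Q. ring. }
    assert (HEm := G_lower_neq_0 l a c (p / q) Hl Hb0 HGl HE).
    destruct (G_expansion l a c (p / q) q n Hl Hb0) as (rho & Hrho & HG);
      try assumption; [unfold n; lia|rewrite Hn; now field|].
    destruct (trinomial_root_near_1 n p 1 0) as (r1 & Hr1 & Hroot);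
      [unfold n; lia|left; auto|].
    assert (Hm : (0 < Rmin r1 rho)%R) by now apply Rmin_pos.
    (* All centers have modulus h, so r/h is the radius for the rescaled roots; it must suit both
       their uniqueness ([r1]) and the expansion ([rho]). *)
    exists (Rmin r1 rho * h)%R. split; [now apply Rmult_lt_0_compat|].
    intros r [Hr Hr'].
    assert (Hrh : (0 < r / h <= Rmin r1 rho)%R).
    { split; [now apply Rdiv_lt_0_compat|].
      apply Rmult_le_reg_r with (1 := Ph). unfold Rdiv.
      rewrite Rmult_assoc, Rinv_l; lra. }
    assert (M1 := Rmin_l r1 rho). assert (M2 := Rmin_r r1 rho).
    destruct (Hroot (r / h)%R) as (d & Hd & Hu); [lra|].
    assert (D0 := disc_neq_0 p q Hp Hq).
    assert (PD : (0 < Cmod (disc p q))%R) by now apply Cmod_gt_0.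
    (* With t = beta/h^n one has zeta = disc t^q, so this bound on |zeta| amounts to |t| < d. *)
    exists (Cmod (disc p q) * d ^ q)%R.
    split; [apply Rmult_lt_0_compat; [assumption|now apply pow_lt]|].
    intros zeta beta Hz Hzeta near.
    set (t := beta / h ^ n).
    assert (hn0 : RtoC h ^ n <> 0) by now apply Cpow_nz.
    assert (Ht : zeta = disc p q * t ^ q).
    { rewrite Hzeta. unfold t. rewrite Cpow_div, <- hq', <- !Cpow_mult_r by assumption.
      rewrite (Nat.mul_comm n q). unfold Cdiv. ring. }
    assert (Htd : (Cmod t < d)%R).
    { apply (Cmod_lt_of_pow t d q Hd). rewrite Ht, Cmod_mult in Hz.
      now apply Rmult_lt_reg_l with (2 := Hz). }
    (* Since beta = ce_j^n (w^j t), every branch solves the same rescaled equation with t rotated by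
       w^j. *)
    set (w := eps q ^ n).
    set (ce := fun j : nat => / eps q ^ j * h).
    assert (ej0 : forall j, eps q ^ j <> 0) by (intros j; apply Cpow_nz, eps_neq_0).
    assert (ejq : forall j, (eps q ^ j) ^ q = 1).
    { intros j. rewrite <- Cpow_mult_r, Nat.mul_comm, Cpow_mult_r, eps_pow_N by assumption.
      apply Cpow_1_l. }
    assert (ce0 : forall j, ce j <> 0).
    { intros j. apply Cmult_neq_0; [|assumption]. intros Q. apply C1_nz.
      rewrite <- (Cinv_r _ (ej0 j)), Q. ring. }
    assert (ceq : forall j, ce j ^ q = g).
    { intros j. unfold ce. rewrite Cpow_mult_l, Cpow_inv, ejq, hq' by auto. field. }
    assert (Cce : forall j, Cmod (ce j) = h).
    { intros j. unfold ce. rewrite Cmod_mult, Cmod_inv, Cmod_pow, Cmod_eps, pow1, Rinv_1 by auto.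
      rewrite Cmod_R, Rabs_pos_eq; lra. }
    assert (w0 : w <> 0) by apply ej0.
    assert (Cw : Cmod w = 1%R).
    { unfold w. rewrite Cmod_pow, Cmod_eps by assumption. apply pow1. }
    assert (Hnear : forall j x, near (S j) x <->
      (Cmod (x / ce j - 1) < r / h)%R /\
      (x / ce j) ^ n - 1 * (x / ce j) ^ p - w ^ j * t = 0).
    { intros j x. unfold near. replace (S j - 1)%nat with j by lia.
      fold (ce j). rewrite <- (Cce j). apply root_near_scale; auto.
      - unfold n at 1. rewrite Cpow_add_r, ceq. ring.
      - unfold ce, w, t. rewrite Cpow_mult_l, Cpow_inv by auto.
        rewrite <- !Cpow_mult_r, (Nat.mul_comm j n), !Cpow_mult_r.
        field. split; [assumption|]. rewrite <- Cpow_mult_r. apply ej0. }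
    split.
    + intros j Hj. destruct j as [|j]; [lia|].
      apply (exists_unique_iff _ _ (Hnear j)).
      apply (exists_unique_scale (ce j) (fun u => (Cmod (u - 1) < r / h)%R /\
         u ^ n - 1 * u ^ p - w ^ j * t = 0)); [auto|].
      apply Hu.
      * replace (1 - 1) with (RtoC 0) by ring. rewrite Cmod_0. lra.
      * replace (w ^ j * t - 0) with (w ^ j * t) by ring.
        rewrite Cmod_mult, Cmod_pow, Cw, pow1. lra.
    + intros x Hx zq dq Hzq Hdq Hzd k Hk.
      destruct (Hadm k Hk) as [Hak HLk].
      set (u := fun j => x (S j) / ce j).
      assert (Hux : forall j, (j < q)%nat -> (Cmod (u j - 1) < r / h)%R /\
         u j ^ n - 1 * u j ^ p - w ^ j * t = 0).
      { intros j Hj. apply Hnear, Hx. lia. }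
      assert (Hgcd : Nat.gcd q n = 1%nat)
        by (unfold n; rewrite Nat.gcd_add_diag_r, Nat.gcd_comm; exact Hpq).
      assert (HX := branch_average l q n k a c (p / q) w t u Hk w0 (ejq n)
        (fun i => eps_pow_coprime_neq_1 q n i Hgcd)).
      (* As n - q = p, the left side is u^n - u^p. *)
      assert (HX1 : forall j, (j < q)%nat -> (1 - / u j ^ q) * u j ^ n = w ^ j * t).
      { intros j Hj. destruct (Hux j Hj) as [H1 H2].
        assert (u0 : u j <> 0) by (apply neq_0_near_1; lra).
        assert (u0p : u j ^ p <> 0) by now apply Cpow_nz.
        assert (u0q : u j ^ q <> 0) by now apply Cpow_nz.
        replace (w ^ j * t) with (u j ^ n - 1 * u j ^ p - (u j ^ n - 1 * u j ^ p - w ^ j * t))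
          by ring.
        rewrite H2. unfold n. rewrite Cpow_add_r. now field. }
      specialize (HX (fun j Hj => HG (u j) ltac:(specialize (Hux j Hj); lra)) HX1).
      set (avg := / q * csum _ q) in HX.
      assert (Ez : a + n * k / q - (l + k)%nat = a - l + p / q * k).
      { rewrite Hn, INRC_add. now field. }
      rewrite pochZ_prefactor, Ez by assumption.
      assert (Hz0 := pochZ_defined_opp (a + n * k / q) (l + k)).
      rewrite Ez in Hz0.
      assert (HF := hyp_of_residue_class _ _ _ _ _ t avg q k
        (fun r => coef_zero p q l a c k r Hp Hk Hal HEm
           ltac:(apply Hz0; intros i Hi; apply Hak; lia) HLk) HX).
      rewrite <- Ht in HF.
      (* The branch condition enters here: it ties the chosen q-th roots to the t of the
         expansion. *)
      assert (Ezq : zq = dq * t).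
      { rewrite Hzd, hR, RtoC_inv, RtoC_pow by (apply pow_nonzero; lra).
        unfold t, Cdiv. ring. }
      rewrite Ezq, Cpow_mult_l, <- Cmult_assoc, HF.
      replace (a + c - l + p * k / q) with (a + c - l + p / q * k) by now field.
      replace (1 / q * sum_n_m _ 1 q) with avg; [ring|].
      unfold avg. rewrite sum_n_m_csum by assumption.
      replace (1 / RtoC q) with (/ RtoC q) by (unfold Cdiv; ring).
      f_equal. apply csum_ext. intros j _.
      replace (S j - 1)%nat with j by lia.
      assert (hR1 : Rpower g (- (1 / q)) = (/ h)%R).
      { specialize (hR 1%nat). change (INR 1) with 1%R in hR. rewrite hR. f_equal. ring. }
      replace (eps q ^ j * Rpower g (- (1 / q)) * x (S j)) with (u j).
      2:{ rewrite hR1, RtoC_inv by lra. unfold u, ce. field. auto. }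
      replace (/ g * x (S j) ^ q) with (u j ^ q).
      2:{ unfold u. rewrite Cpow_div, ceq by auto. unfold Cdiv. ring. }
      change (eps q ^ n) with w. ring.
  - intros (Ha & HE & HGl & Hadm) beta Hbeta.
    assert (Hn1 : (0 < n)%nat) by (unfold n; lia).
    assert (p0 : RtoC p <> 0) by (apply INRC_neq_0; lia).
    assert (q0 : RtoC q <> 0) by (apply INRC_neq_0; lia).
    assert (n0 : RtoC n <> 0) by (apply INRC_neq_0; lia).
    assert (Hal := pochZ_defined_opp _ _ Ha).
    destruct (Rpower_root beta n Hbeta Hn1) as (Ph & hn & hR).
    set (h := Rpower beta (1 / n)) in *.
    assert (h0 : RtoC h <> 0) by now apply RtoC_neq_0.
    assert (hn' : RtoC h ^ n = beta) by now rewrite <- RtoC_pow, hn.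
    assert (Hn : RtoC n = RtoC p + q) by apply INRC_add.
    (* The parameter beta of the expansion: 1 + b = q/n, so that N = n forces e = q. *)
    set (b := - (RtoC p / n)).
    assert (Ebb : RtoC p / n = - b) by (unfold b; ring).
    change (RtoC (INR (p + q))) with (RtoC n) in HGl.
    rewrite Ebb in *.
    assert (Hb0 : b <> 0).
    { intros Q. apply p0. replace (RtoC p) with (p / n * n) by now field.
      rewrite Ebb, Q. ring. }
    assert (HEm := G_lower_neq_0 l a c b Hl Hb0 HGl HE).
    destruct (G_expansion l a c b n q Hl Hb0) as (rho & Hrho & HG);
      try assumption; [unfold b; rewrite Hn in *; now field|].
    destruct (trinomial_root_near_1 n p 0 1) as (r1 & Hr1 & Hroot);
      [unfold n; lia|right; auto|].
    assert (Hm : (0 < Rmin r1 rho)%R) by now apply Rmin_pos.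
    exists (Rmin r1 rho * h)%R. split; [now apply Rmult_lt_0_compat|].
    intros r [Hr Hr'].
    assert (Hrh : (0 < r / h <= Rmin r1 rho)%R).
    { split; [now apply Rdiv_lt_0_compat|].
      apply Rmult_le_reg_r with (1 := Ph). unfold Rdiv.
      rewrite Rmult_assoc, Rinv_l; lra. }
    assert (M1 := Rmin_l r1 rho). assert (M2 := Rmin_r r1 rho).
    destruct (Hroot (r / h)%R) as (d & Hd & Hu); [lra|].
    assert (D0 := disc_neq_0 p q Hp Hq).
    assert (PD : (0 < Cmod (disc p q))%R) by now apply Cmod_gt_0.
    assert (Pdn : (0 < d ^ n)%R) by now apply pow_lt.
    (* Now 1/zeta = t^n/disc with t = g/h^q, so |zeta| above this bound means |t| < d. *)
    exists (Cmod (disc p q) / d ^ n)%R.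
    split; [now apply Rdiv_lt_0_compat|].
    intros zeta g Hz Hzeta near.
    set (t := g / h ^ q).
    assert (hq0 : RtoC h ^ q <> 0) by now apply Cpow_nz.
    assert (b0 : RtoC beta <> 0) by now apply RtoC_neq_0.
    assert (Pz : (0 < Cmod zeta)%R).
    { assert (0 < Cmod (disc p q) / d ^ n)%R by now apply Rdiv_lt_0_compat. lra. }
    assert (z0 : zeta <> 0) by now apply Cmod_gt_0.
    assert (gn0 : g ^ n <> 0).
    (* The inverse of 0 is 0 by convention, so g^n = 0 would give zeta = 0, against |zeta| > M. *)
    { intros Q. apply z0. rewrite Hzeta, Q. unfold Cdiv.
      replace (/ 0) with (RtoC 0); [ring|].
      apply injective_projections; simpl; unfold Rdiv; ring. }
    assert (bq0 : RtoC beta ^ q <> 0) by now apply Cpow_nz.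
    assert (Htn : t ^ n = g ^ n / beta ^ q).
    { unfold t. rewrite Cpow_div, <- hn', <- !Cpow_mult_r by assumption.
      now rewrite (Nat.mul_comm n q). }
    assert (Ht : / zeta = / disc p q * t ^ n).
    { rewrite Hzeta, Htn. field. auto. }
    assert (Htd : (Cmod t < d)%R).
    { apply (Cmod_lt_of_pow t d n Hd).
      replace (t ^ n) with (disc p q / zeta) by (unfold Cdiv; rewrite Ht; now field).
      rewrite Cmod_div by assumption.
      apply Rmult_lt_reg_r with (1 := Pz). unfold Rdiv.
      rewrite Rmult_assoc, Rinv_l, Rmult_1_r by lra.
      apply Rmult_lt_compat_l with (1 := Pdn) in Hz.
      replace (d ^ n * (Cmod (disc p q) / d ^ n))%R with (Cmod (disc p q)) in Hz
        by (field; lra).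
      exact Hz. }
    set (w := eps n ^ q).
    set (ce := fun j : nat => / eps n ^ j * h).
    assert (ej0 : forall j, eps n ^ j <> 0) by (intros j; apply Cpow_nz, eps_neq_0).
    assert (ejn : forall j, (eps n ^ j) ^ n = 1).
    { intros j. rewrite <- Cpow_mult_r, Nat.mul_comm, Cpow_mult_r, eps_pow_N by assumption.
      apply Cpow_1_l. }
    assert (ce0 : forall j, ce j <> 0).
    { intros j. apply Cmult_neq_0; [|assumption]. intros Q. apply C1_nz.
      rewrite <- (Cinv_r _ (ej0 j)), Q. ring. }
    assert (cen : forall j, ce j ^ n = beta).
    { intros j. unfold ce. rewrite Cpow_mult_l, Cpow_inv, ejn, hn' by auto. field. }
    assert (Cce : forall j, Cmod (ce j) = h).
    { intros j. unfold ce. rewrite Cmod_mult, Cmod_inv, Cmod_pow, Cmod_eps, pow1, Rinv_1 by auto.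
      rewrite Cmod_R, Rabs_pos_eq; lra. }
    assert (w0 : w <> 0) by apply ej0.
    assert (Cw : Cmod w = 1%R).
    { unfold w. rewrite Cmod_pow, Cmod_eps by assumption. apply pow1. }
    assert (ceq : forall j, ce j ^ q * (w ^ j * t) = g).
    { intros j. unfold ce, w, t. rewrite Cpow_mult_l, Cpow_inv by auto.
      rewrite <- !Cpow_mult_r, (Nat.mul_comm j q).
      field. split; [assumption|apply ej0]. }
    assert (Hnear : forall j x, near (S j) x <->
      (Cmod (x / ce j - 1) < r / h)%R /\
      (x / ce j) ^ n - w ^ j * t * (x / ce j) ^ p - 1 = 0).
    { intros j x. unfold near. replace (S j - 1)%nat with j by lia.
      fold (ce j). rewrite <- (Cce j). apply root_near_scale; auto.
      - rewrite <- (ceq j). unfold n at 1. rewrite Cpow_add_r. ring.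
      - rewrite cen. ring. }
    split.
    + intros j Hj. destruct j as [|j]; [lia|].
      apply (exists_unique_iff _ _ (Hnear j)).
      apply (exists_unique_scale (ce j) (fun u => (Cmod (u - 1) < r / h)%R /\
         u ^ n - w ^ j * t * u ^ p - 1 = 0)); [auto|].
      apply Hu.
      * replace (w ^ j * t - 0) with (w ^ j * t) by ring.
        rewrite Cmod_mult, Cmod_pow, Cw, pow1. lra.
      * replace (1 - 1) with (RtoC 0) by ring. rewrite Cmod_0. lra.
    + intros x Hx zq dq Hzq Hdq Hzd k Hk.
      destruct (Hadm k Hk) as [Hak HLk].
      set (u := fun j => x (S j) / ce j).
      assert (Hux : forall j, (j < n)%nat -> (Cmod (u j - 1) < r / h)%R /\
         u j ^ n - w ^ j * t * u j ^ p - 1 = 0).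
      { intros j Hj. apply Hnear, Hx. lia. }
      assert (Hgcd : Nat.gcd n q = 1%nat)
        by (rewrite Nat.gcd_comm; unfold n;
            rewrite Nat.gcd_add_diag_r, Nat.gcd_comm; exact Hpq).
      assert (HX := branch_average l n q k a c b w t u Hk w0 (ejn q)
        (fun i => eps_pow_coprime_neq_1 n q i Hgcd)).
      (* As n - q = p, the left side is (u^n - 1)/u^p: the root equation divided by u^p. *)
      assert (HX1 : forall j, (j < n)%nat -> (1 - / u j ^ n) * u j ^ q = w ^ j * t).
      { intros j Hj. destruct (Hux j Hj) as [H1 H2].
        assert (u0 : u j <> 0) by (apply neq_0_near_1; lra).
        assert (u0p : u j ^ p <> 0) by now apply Cpow_nz.
        assert (u0q : u j ^ q <> 0) by now apply Cpow_nz.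
        replace (w ^ j * t) with ((u j ^ n - 1 - (u j ^ n - w ^ j * t * u j ^ p - 1)) / u j ^ p)
          by now field.
        rewrite H2. unfold n. rewrite Cpow_add_r. now field. }
      specialize (HX (fun j Hj => HG (u j) ltac:(specialize (Hux j Hj); lra)) HX1).
      set (avg := / n * csum _ n) in HX.
      assert (Ez : a + q * k / n - (l + k)%nat = a - l + b * k).
      { unfold b. rewrite INRC_add. replace (RtoC q) with (n - p) by (rewrite Hn; ring).
        now field. }
      rewrite pochZ_prefactor, Ez by assumption.
      assert (Hz0 := pochZ_defined_opp (a + q * k / n) (l + k)).
      rewrite Ez in Hz0.
      assert (HF := hyp_of_residue_class _ _ _ _ _ t avg n k
        (fun r => coef_infty p q l a c k r Hp Hq Hk Hal HEm
           ltac:(apply Hz0; intros i Hi; apply Hak; lia) HLk) HX).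
      rewrite <- Ht in HF.
      assert (Ezq : zq = dq * t).
      { rewrite Hzd, hR, RtoC_inv, RtoC_pow by (apply pow_nonzero; lra).
        unfold t, Cdiv. ring. }
      rewrite Ezq, Cpow_mult_l, <- Cmult_assoc, HF.
      fold n. fold b.
      replace (a + c - l - p * k / n) with (a + c - l + b * k) by (unfold b; now field).
      replace (1 / n * sum_n_m _ 1 n) with avg; [ring|].
      unfold avg. rewrite sum_n_m_csum by assumption.
      replace (1 / RtoC n) with (/ RtoC n) by (unfold Cdiv; ring).
      f_equal. apply csum_ext. intros j _.
      replace (S j - 1)%nat with j by lia.
      assert (hR1 : Rpower beta (- (1 / n)) = (/ h)%R).
      { specialize (hR 1%nat). change (INR 1) with 1%R in hR. rewrite hR. f_equal. ring. }
      replace (eps n ^ j * Rpower beta (- (1 / n)) * x (S j)) with (u j).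
      2:{ rewrite hR1, RtoC_inv by lra. unfold u, ce. field. auto. }
      replace (/ beta * x (S j) ^ n) with (u j ^ n).
      2:{ unfold u. rewrite Cpow_div, cen by auto. unfold Cdiv. ring. }
      change (eps n ^ q) with w. ring.
Qed.
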